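(* If $\diamondsuit$ holds, then there is a Souslin tree $T$ that is $n$-fold Souslin off the generic branch for every finite $n$, and consequently $T$ is $n$-absolutely UBP and $n$-absolutely rigid for every $n<\omega$.
   Context: $\diamondsuit$: there is $\langle D_\alpha:\alpha<\omega_1\rangle$ with $D_\alpha\subseteq\alpha$ such that for every $A\subseteq\omega_1$, $\{\alpha: A\cap\alpha=D_\alpha\}$ is stationary. A Souslin tree is a normal $\omega_1$-tree (countable levels, every node has at least two immediate successors, limit nodes determined by predecessors, every node has successors at every higher level) with no uncountable antichain. Forcing with a tree uses the reversed order; $T^n$ is the $n$-fold product, adding $n$ generic branches. $T_p=\{q:q\ge_T p\}$. $T$ is $n$-fold Souslin off the generic branch if after forcing with $T^n$ to add branches $b_1,\dots,b_n$, $T_p$ is Souslin for every $p$ not on any $b_i$. $T$ is $n$-absolutely UBP if forcing with $T^{n+1}$ adds exactly $n+1$ new cofinal branches through $T$; $n$-absolutely rigid if $T$ has no nontrivial automorphism in every extension by $T^n$. *)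

(* Defs.v *)
From mathcomp Require Import all_boot.

(* A [universe] interprets second-order statements about ground-model sets
   (types): [sub A] are the subsets of A in that universe, [tv] its truth values.
   Each notion below is a formula written once, and read both in the ground model
   and in the generic extensions. *)
Record universe := Universe {
  tv   : Type;
  sub  : Type -> Type;
  tmem : forall A : Type, A -> sub A -> tv;
  temb : Prop -> tv;
  tand : tv -> tv -> tv;
  tor  : tv -> tv -> tv;
  timp : tv -> tv -> tv;
  tneg : tv -> tv;
  tall : forall A : Type, (A -> tv) -> tv;
  tex  : forall A : Type, (A -> tv) -> tv
}.

Arguments tmem {u A}.
Arguments temb {u}.
Arguments tand {u}.
Arguments tor {u}.
Arguments timp {u}.
Arguments tneg {u}.
Arguments tall {u A}.
Arguments tex {u A}.

Definition ground : universe := {|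
  tv := Prop;
  sub := fun A => A -> Prop;
  tmem := fun A a X => X a;
  temb := fun P => P;
  tand := fun a b => a /\ b;
  tor := fun a b => a \/ b;
  timp := fun a b => a -> b;
  tneg := fun a => ~ a;
  tall := fun A F => forall x, F x;
  tex := fun A F => exists x, F x
|}.

Record poset := Poset {
  cond : Type;
  stronger : cond -> cond -> Prop
}.
Arguments stronger {p}.

Definition dense_below (P : poset) (p : cond P) (D : cond P -> Prop) : Prop :=
  forall q, stronger q p -> exists r, stronger r q /\ D r.
Arguments dense_below {P}.

(* The truth value of a formula is the set of conditions forcing it. A name for a
   subset of the ground-model set A is a subset X of A * P, and is evaluated by a
   generic G as {a | exists s in G, (a, s) in X}; every subset of A in the
   extension has such a name. *)
Definition forcing (P : poset) : universe := {|
  tv := cond P -> Prop;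
  sub := fun A => A -> cond P -> Prop;
  tmem := fun A a X p =>
    dense_below p (fun q => exists s, stronger q s /\ X a s);
  temb := fun Q _ => Q;
  tand := fun a b p => a p /\ b p;
  tor := fun a b p => dense_below p (fun q => a q \/ b q);
  timp := fun a b p => forall q, stronger q p -> a q -> b q;
  tneg := fun a p => forall q, stronger q p -> ~ a q;
  tall := fun A F p => forall x, F x p;
  tex := fun A F p => dense_below p (fun q => exists x, F x q)
|}.

Definition forced (P : poset) (phi : tv (forcing P)) : Prop :=
  forall p : cond P, phi p.

Declare Scope fm_scope.
Delimit Scope fm_scope with fm.
Bind Scope fm_scope with tv.
Notation "⌜ P ⌝" := (temb P%type) (at level 0, P at level 200) : fm_scope.
Notation "a ∈ X" := (tmem a X) (at level 70, no associativity) : fm_scope.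
Notation "a /\ b" := (tand a b) : fm_scope.
Notation "a \/ b" := (tor a b) : fm_scope.
Notation "~ a" := (tneg a) : fm_scope.
Notation "a ⇒ b" := (timp a b) (at level 90, right associativity) : fm_scope.
Notation "a <-> b" := (tand (timp a b) (timp b a)) : fm_scope.
Notation "'FA' x .. y , F" := (tall (fun x => .. (tall (fun y => F%fm)) ..))
  (at level 200, x binder, y binder, right associativity) : fm_scope.
Notation "'EX' x .. y , F" := (tex (fun x => .. (tex (fun y => F%fm)) ..))
  (at level 200, x binder, y binder, right associativity) : fm_scope.

Record ordset := Ordset {
  pt :> Type;
  lt : pt -> pt -> Prop
}.
Arguments lt {o}.

Definition le {T : ordset} (s t : T) : Prop := s = t \/ lt s t.

Section Formulas.
Variable U : universe.
Local Open Scope fm_scope.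

Definition whole (A : Type) : A -> tv U := fun _ => ⌜True⌝.

Definition is_function {A B : Type} (X : A -> tv U) (Y : B -> tv U)
    (f : sub U (A * B)) : tv U :=
  (FA a b, (a, b) ∈ f ⇒ X a /\ Y b) /\
  (FA a, X a ⇒ EX b, (a, b) ∈ f) /\
  (FA a b b', (a, b) ∈ f /\ (a, b') ∈ f ⇒ ⌜b = b'⌝).

Definition is_injective {A B : Type} (f : sub U (A * B)) : tv U :=
  FA a a' b, (a, b) ∈ f /\ (a', b) ∈ f ⇒ ⌜a = a'⌝.

Definition is_onto {A B : Type} (Y : B -> tv U) (f : sub U (A * B)) : tv U :=
  FA b, Y b ⇒ EX a, (a, b) ∈ f.

Definition is_countable {A : Type} (X : A -> tv U) : tv U :=
  EX f : sub U (A * nat), is_function X (whole nat) f /\ is_injective f.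

Definition is_order_iso {A B : ordset} (X : A -> tv U) (Y : B -> tv U)
    (f : sub U (A * B)) : tv U :=
  is_function X Y f /\ is_injective f /\ is_onto Y f /\
  (FA a a' b b', (a, b) ∈ f /\ (a', b') ∈ f ⇒ (⌜lt a a'⌝ <-> ⌜lt b b'⌝)).

Definition is_strict_order (A : ordset) : tv U :=
  (FA a : A, ~ ⌜lt a a⌝) /\
  (FA a b c : A, ⌜lt a b⌝ /\ ⌜lt b c⌝ ⇒ ⌜lt a c⌝).

Definition is_well_ordered {A : ordset} (X : A -> tv U) : tv U :=
  FA Y : sub U A, (FA a, a ∈ Y ⇒ X a) /\ (EX a, a ∈ Y) ⇒
    EX m, m ∈ Y /\ FA a, a ∈ Y ⇒ ⌜le m a⌝.

(* W is a ground-model ordinal: in an extension this formula says that it is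
   the omega_1 of that extension. *)
Definition is_omega1 (W : ordset) : tv U :=
  is_strict_order W /\ is_well_ordered (whole W) /\
  (FA a : W, is_countable (fun b : W => ⌜lt b a⌝)) /\
  ~ is_countable (whole W).

Variables W T : ordset.

Definition at_level (t : T) (a : W) : tv U :=
  EX f : sub U (T * W),
    is_order_iso (fun s : T => ⌜lt s t⌝) (fun b : W => ⌜lt b a⌝) f.

Definition is_tree : tv U :=
  is_strict_order T /\ FA t : T, is_well_ordered (fun s : T => ⌜lt s t⌝).

Definition has_height : tv U :=
  (FA t : T, EX a : W, at_level t a) /\ (FA a : W, EX t : T, at_level t a).

Definition immediate_succ (s t : T) : tv U :=
  ⌜lt s t⌝ /\ ~ EX u : T, ⌜lt s u⌝ /\ ⌜lt u t⌝.

(* Zero counts as a limit, so a normal tree has a unique root. *)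
Definition is_limit (a : W) : tv U :=
  ~ EX b : W, ⌜lt b a⌝ /\ FA c : W, ⌜lt c a⌝ ⇒ ⌜le c b⌝.

Definition is_normal_omega1_tree : tv U :=
  is_omega1 W /\ is_tree /\ has_height /\
  (FA a : W, is_countable (fun t : T => at_level t a)) /\
  (FA s : T, EX t t' : T, ⌜t <> t'⌝ /\ immediate_succ s t /\ immediate_succ s t') /\
  (FA (a : W) (s t : T), is_limit a /\ at_level s a /\ at_level t a /\
     (FA u : T, ⌜lt u s⌝ <-> ⌜lt u t⌝) ⇒ ⌜s = t⌝) /\
  (FA (t : T) (a b : W), at_level t a /\ ⌜lt a b⌝ ⇒
     EX s : T, ⌜lt t s⌝ /\ at_level s b).

Definition is_antichain (X : sub U T) : tv U :=
  FA s t : T, s ∈ X /\ t ∈ X /\ ⌜s <> t⌝ ⇒ ~ ⌜lt s t⌝ /\ ~ ⌜lt t s⌝.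

Definition is_souslin : tv U :=
  is_normal_omega1_tree /\
  ~ EX X : sub U T, is_antichain X /\ ~ is_countable (fun t : T => t ∈ X).

Definition is_cofinal_branch (X : sub U T) : tv U :=
  (FA s t : T, s ∈ X /\ t ∈ X ⇒ ⌜le s t⌝ \/ ⌜lt t s⌝) /\
  (FA s t : T, ⌜lt s t⌝ /\ t ∈ X ⇒ s ∈ X) /\
  (FA a : W, EX t : T, at_level t a /\ t ∈ X).

Definition same_set (X Y : sub U T) : tv U := FA t : T, t ∈ X <-> t ∈ Y.

(* Here [T -> Prop] ranges over the subsets of T in the ground model. *)
Definition is_new (X : sub U T) : tv U :=
  ~ EX B : T -> Prop, FA t : T, t ∈ X <-> ⌜B t⌝.

Definition exactly_new_cofinal_branches (k : nat) : tv U :=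
  EX B : 'I_k -> sub U T,
    (FA i, is_cofinal_branch (B i) /\ is_new (B i)) /\
    (FA i j, ⌜i <> j⌝ ⇒ ~ same_set (B i) (B j)) /\
    (FA X : sub U T, is_cofinal_branch X /\ is_new X ⇒ EX i, same_set X (B i)).

Definition is_rigid : tv U :=
  FA f : sub U (T * T), is_order_iso (whole T) (whole T) f ⇒
    FA t : T, (t, t) ∈ f.

End Formulas.

Definition cone (T : ordset) (p : T) : ordset := {|
  pt := {q : T | le p q};
  lt := fun x y => lt (proj1_sig x) (proj1_sig y)
|}.

Definition tree_power (T : ordset) (n : nat) : poset := {|
  cond := 'I_n -> T;
  stronger := fun p q => forall i, le (q i) (p i)
|}.

(* The name of {t | exists p in G, t <= p i}. *)
Definition generic_branch (T : ordset) (n : nat) (i : 'I_n) :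
    sub (forcing (tree_power T n)) T :=
  fun t p => le t (p i).

Definition souslin_off_generic_branch (W T : ordset) (n : nat) : Prop :=
  forced (tree_power T n)
    (FA p : T, (FA i : 'I_n, ~ (p ∈ generic_branch T n i)) ⇒
       is_souslin (forcing (tree_power T n)) W (cone T p))%fm.

Definition absolutely_UBP (W T : ordset) (n : nat) : Prop :=
  forced (tree_power T n.+1)
    (exactly_new_cofinal_branches (forcing (tree_power T n.+1)) W T n.+1).

Definition absolutely_rigid (T : ordset) (n : nat) : Prop :=
  forced (tree_power T n) (is_rigid (forcing (tree_power T n)) T).

Definition unbounded (W : ordset) (C : W -> Prop) : Prop :=
  forall a, exists b, lt a b /\ C b.

Definition closed (W : ordset) (C : W -> Prop) : Prop :=
  forall a, (exists b, lt b a) ->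
    (forall b, lt b a -> exists c, lt b c /\ lt c a /\ C c) -> C a.

Definition stationary (W : ordset) (S : W -> Prop) : Prop :=
  forall C : W -> Prop, closed W C -> unbounded W C -> exists a, C a /\ S a.

Definition diamond (W : ordset) : Prop :=
  exists D : W -> W -> Prop,
    (forall a b, D a b -> lt b a) /\
    forall A : W -> Prop,
      stationary W (fun a => forall b, (A b /\ lt b a) <-> D a b).

(* Main.v *)
Require Import Defs.
From mathcomp Require Import all_boot.
From mathcomp Require Import boolp classical_sets functions cardinality.

(* The forest built here is free: for every finite I and every set D of I-tuples of
   nodes there is a level a such that each tuple above level a whose entries have
   distinct restrictions to level a decides D, i.e. lies above a member of D or has
   no extension in D. At a limit level d the branches are chosen so that all tuples
   of distinct branches are generic for the set of tuples below d that diamond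
   guesses; reflecting D at a guess closed under taking witnesses gives freeness.
   The tree is a cone of this forest. Freeness makes T^n omega-distributive (below
   tuples of incomparable nodes), so omega_1 is preserved and levels are absolute.
   Off the generic branches one decides, in T^{n+1}, whether x has a predecessor in
   a named antichain (which bounds the antichain), or whether x is off a named
   branch (which shows that the branch is generic). For a named automorphism f
   moving a node one decides in T^{n+2} whether f(x) is incomparable with y, which
   is impossible when y = f(x). *)

Set Implicit Arguments.
Unset Strict Implicit.
Unset Printing Implicit Defensive.
Local Open Scope classical_set_scope.

(** * Countable sets *)

Lemma countable_injectionP (A : Type) (X : set A) :
  countable X <->
  exists f : A -> nat, forall a b, X a -> X b -> f a = f b -> a = b.
Proof.
split=> [/countable_injP [f f_inj]|[f f_inj]].
  by exists f => a b Xa Xb; apply: f_inj; rewrite inE.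
by apply/countable_injP; exists f => a b; rewrite !inE; apply: f_inj.
Qed.

Lemma countable_inj (A B : Type) (X : set A) (Y : set B) (g : A -> B) :
  (forall a, X a -> Y (g a)) ->
  (forall a b, X a -> X b -> g a = g b -> a = b) -> countable Y -> countable X.
Proof.
move=> XY g_inj /countable_injectionP [f f_inj]; apply/countable_injectionP.
exists (f \o g) => a b Xa Xb fg; apply: g_inj => //.
by apply: f_inj fg; apply: XY.
Qed.

Lemma countable_subset (A : Type) (X Y : set A) :
  X `<=` Y -> countable Y -> countable X.
Proof. by move=> XY; apply: sub_countable; apply: subset_card_le. Qed.

Lemma countable_image (A B : Type) (g : A -> B) (X : set A) :
  countable X -> countable (g @` X).
Proof. exact/sub_countable/card_image_le. Qed.

Lemma countable_setU (A : Type) (X Y : set A) :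
  countable X -> countable Y -> countable (X `|` Y).
Proof.
by move=> Xc Yc; rewrite -bigcup2E; apply: bigcup_countable => // -[|[|]] /=.
Qed.

Lemma infinite_injection (A : Type) (X : set A) :
  infinite_set X -> exists2 x : nat -> A, injective x & forall n, X (x n).
Proof.
elim/Ppointed: A => A in X *; first by rewrite emptyE => -[].
move=> /infiniteP/ppcard_leP [x]; exists x; last by move=> n; apply: funS.
by move=> m n; apply: (@inj _ _ setT x); rewrite inE.
Qed.

Lemma countable_seqs (A : Type) (X : set A) :
  countable X -> countable [set s : seq A | all (mem X) s].
Proof.
move=> /countable_injectionP [f f_inj].
apply: (@countable_inj _ (seq nat) _ setT (map f)) => //.
elim=> [|a s IH] [|b t] //= /andP [Xa Xs] /andP [Xb Xt] [fab fst].
move: Xa Xb; rewrite !inE => Xa Xb.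
by rewrite (f_inj a b Xa Xb fab) (IH t Xs Xt fst).
Qed.

Lemma map_enum_inj (I : finType) (A : Type) (f g : I -> A) :
  map f (enum I) = map g (enum I) -> f = g.
Proof.
move=> fg; apply/funext => i; have := mem_enum I i; rewrite inE.
elim: (enum I) fg => //= j s IH [fgj fgs].
by rewrite in_cons => /orP [/eqP ->|/(IH fgs)].
Qed.

Lemma all_map_enum (I : finType) (A : Type) (X : set A) (f : I -> A) :
  (forall i, X (f i)) -> all (mem X) (map f (enum I)).
Proof. by move=> Xf; rewrite all_map; apply/allP => i _; rewrite /= inE. Qed.

Lemma countable_tuples (I : finType) (A : Type) (X : set A) :
  countable X -> countable [set f : I -> A | forall i, X (f i)].
Proof.
move/countable_seqs; apply: (@countable_inj _ _ _ _ (fun f => map f (enum I))).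
  exact: all_map_enum.
by move=> f g _ _; apply: map_enum_inj.
Qed.

Lemma ground_countableP (A : Type) (X : A -> Prop) :
  is_countable ground X <-> countable X.
Proof.
split=> [[f [[_ [f_tot _]] f_inj]]|/countable_injectionP [f f_inj]].
  have /choice [g fg] : forall a, exists n, X a -> f (a, n).
    move=> a; have [/f_tot [n]|] := pselect (X a); first by exists n.
    by exists 0.
  apply/countable_injectionP; exists g => a b Xa Xb gab.
  by apply: (f_inj a b (g a)); split; [apply: fg|rewrite gab; apply: fg].
exists (fun x => X x.1 /\ f x.1 = x.2); split; last first.
  by move=> a b n /= [[Xa fa] [Xb fb]]; apply: f_inj; rewrite ?fa.
split=> [a n [] //|]; split=> [a Xa|a m n /= [[_ <-] [_ <-]] //].
by exists (f a).
Qed.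

(** * Orders and the first uncountable ordinal *)

Class strict_order (T : ordset) : Prop := StrictOrder {
  lt_irr : forall a : T, ~ lt a a;
  lt_trans : forall b a c : T, lt a b -> lt b c -> lt a c
}.

Section StrictOrder.
Context {T : ordset} {soT : strict_order T}.
Implicit Types a b c : T.

Lemma le_refl a : le a a. Proof. by left. Qed.

Lemma lt_le a b : lt a b -> le a b. Proof. by right. Qed.

Lemma le_lt_trans b a c : le a b -> lt b c -> lt a c.
Proof. by case=> [->|/lt_trans h] // /h. Qed.

Lemma lt_le_trans b a c : lt a b -> le b c -> lt a c.
Proof. by move=> ab [<-|/(lt_trans ab)]. Qed.

Lemma le_trans b a c : le a b -> le b c -> le a c.
Proof. by case=> [->|ab] // bc; right; apply: lt_le_trans bc. Qed.

Lemma lt_neq a b : lt a b -> a <> b.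
Proof. by move=> ab eab; move: ab; rewrite eab => /lt_irr. Qed.

Lemma lt_nge a b : lt a b -> ~ le b a.
Proof. by move=> ab ba; apply: (@lt_irr T _ a); apply: lt_le_trans ba. Qed.

Lemma le_anti a b : le a b -> le b a -> a = b.
Proof. by case=> // ab /(lt_nge ab). Qed.

End StrictOrder.

#[local] Hint Resolve le_refl : core.

Class well_order (W : ordset) : Prop := WellOrder {
  well_order_strict :: strict_order W;
  has_least : forall X : set W, (exists a, X a) ->
             exists2 m, X m & forall a, X a -> le m a
}.

Section WellOrder.
Context {W : ordset} {woW : well_order W}.
Implicit Types (a b c d : W) (X : set W).

Lemma le_total a b : le a b \/ lt b a.
Proof.
have [|m abm m_min] := has_least (X := [set a; b]); first by exists a; left.
have [ma mb] := (m_min a (or_introl erefl), m_min b (or_intror erefl)).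
by case: abm => em; [left; rewrite -{1}em|case: ma => [<-|]; rewrite em;
  [left|right]].
Qed.

Lemma not_le a b : ~ le a b -> lt b a.
Proof. by case: (le_total a b). Qed.

Lemma not_lt a b : ~ lt a b -> le b a.
Proof. by case: (le_total b a). Qed.

Lemma lt_wf : well_founded (@lt W).
Proof.
move=> a; apply: contrapT => na.
have [|m nm m_min] := has_least (X := [set b | ~ Acc (@lt W) b]).
  by exists a.
apply: nm; constructor => b bm; apply: contrapT => nb.
exact: lt_nge bm (m_min b nb).
Qed.

Lemma increasing_ge (f : W -> W) :
  (forall a b, lt a b -> lt (f a) (f b)) -> forall a, le a (f a).
Proof.
move=> f_incr a; apply: not_lt => fa.
have [|m fm m_min] := has_least (X := [set b | lt (f b) b]); first by exists a.
exact: lt_nge fm (m_min (f m) (f_incr _ _ fm)).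
Qed.

Lemma increasing_lt (f : W -> W) :
  (forall a b, lt a b -> lt (f a) (f b)) ->
  forall a b, lt a b <-> lt (f a) (f b).
Proof.
move=> f_incr a b; split; first exact: f_incr.
move=> fab; apply: not_le => -[eba|/f_incr fba].
  by move: fab; rewrite eba => /lt_irr.
exact: lt_irr (lt_trans fab fba).
Qed.

Lemma increasing_inj (f : W -> W) :
  (forall a b, lt a b -> lt (f a) (f b)) -> injective f.
Proof.
move=> f_incr a b fab; apply: le_anti; apply: not_lt => /f_incr; rewrite fab;
  exact: lt_irr.
Qed.

Lemma finite_bounded_below (I : finType) (g : I -> W) a d :
  lt a d -> (forall i, lt (g i) d) ->
  exists2 b, lt b d & forall i, le (g i) b.
Proof.
move=> ad gd.
suff [b bd bs] : exists2 b, lt b d & forall i, i \in enum I -> le (g i) b.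
  by exists b => // i; apply: bs; rewrite mem_enum.
elim: (enum I) => [|i s [b bd bs]]; first by exists a.
have [gb|bg] := le_total (g i) b.
  by exists b => // j; rewrite in_cons => /orP [/eqP ->|/bs].
exists (g i) => // j; rewrite in_cons => /orP [/eqP -> //|/bs jb].
by right; apply: le_lt_trans bg.
Qed.

End WellOrder.

Lemma well_founded_choice (W A : Type) (R : W -> W -> Prop) (a0 : A)
    (Phi : W -> (W -> A) -> A -> Prop) :
  well_founded R -> (forall b a c, R a b -> R b c -> R a c) ->
  (forall d h h' x, (forall b, R b d -> h b = h' b) ->
    Phi d h x -> Phi d h' x) ->
  (forall d h, (forall b, R b d -> Phi b h (h b)) -> exists x, Phi d h x) ->
  exists H : W -> A, forall d, Phi d H (H d).
Proof.
move=> R_wf R_trans Phi_ext Phi_ex.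
have /choice [F Phi_F] : forall dh : W * (W -> A), exists x,
    (forall b, R b dh.1 -> Phi b dh.2 (dh.2 b)) -> Phi dh.1 dh.2 x.
  move=> [d h] /=.
  have [/Phi_ex [x]|] := pselect (forall b, R b d -> Phi b h (h b)).
    by exists x.
  by exists a0.
pose cut d (r : forall b, R b d -> A) b : A :=
  if pselect (R b d) is left bd then r b bd else a0.
pose H := Fix R_wf (fun _ => A) (fun d r => F (d, cut d r)).
have H_eq d : H d = F (d, cut d (fun b _ => H b)).
  rewrite /H Fix_eq // => x r r' rr'; congr (F (_, cut _ _)).
  by apply: functional_extensionality_dep => b; apply/funext.
have H_cut d b : R b d -> H b = cut d (fun b _ => H b) b.
  by rewrite /cut; case: pselect.
exists H; elim/(well_founded_ind R_wf) => d IH.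
apply: (Phi_ext d (cut d (fun b _ => H b))) => [b /H_cut //|].
rewrite H_eq; apply: (Phi_F (d, _)) => b bd /=.
rewrite -H_cut //; apply: Phi_ext (IH b bd) => c cb.
by apply: H_cut; apply: R_trans bd.
Qed.

Class omega1 (W : ordset) : Prop := Omega1 {
  omega1_well_order :: well_order W;
  countable_lt : forall a : W, countable [set b | lt b a];
  omega1_uncountable : ~ countable [set: W]
}.

Lemma ground_omega1 (W : ordset) : is_omega1 ground W -> omega1 W.
Proof.
case=> [[irr tr] [wo [seg unc]]]; split.
- split; first by split=> // b a c ab bc; apply: (tr a b c).
  by move=> X X0; have [|m [Xm m_min]] := wo X; last by exists m.
- by move=> a; apply/ground_countableP/seg.
by move/ground_countableP.
Qed.

Section Omega1.
Context {W : ordset} {oW : omega1 W}.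
Implicit Types a b c d : W.

Lemma countable_le a : countable [set b | le b a].
Proof.
apply: (@countable_subset _ _ ([set b | lt b a] `|` [set a])).
  by move=> b [->|]; [right|left].
by apply: countable_setU; [apply: countable_lt|apply: countable1].
Qed.

Lemma countable_bounded (A : Type) (X : set A) (g : A -> W) :
  countable X -> exists c, forall x, X x -> lt (g x) c.
Proof.
move=> Xc; apply: contrapT => unbounded; apply: omega1_uncountable.
apply: (@countable_subset _ _ (\bigcup_(x in X) [set b | le b (g x)])).
  move=> c _; apply: contrapT => nc; apply: unbounded; exists c => x Xx.
  by apply: not_le => cg; apply: nc; exists x.
by apply: bigcup_countable => // x _; apply: countable_le.
Qed.

Lemma omega1_inhabited : exists a : W, True.
Proof.
by have [c _] := @countable_bounded W set0 id (countable0 W); exists c.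
Qed.

Lemma omega1_gt2 a b : exists c, lt a c /\ lt b c.
Proof.
have [c abc] := countable_bounded (fun x : bool => if x then a else b)
  (countableP setT).
by exists c; split; [apply: (abc true)|apply: (abc false)].
Qed.

Lemma omega1_gt a : exists b, lt a b.
Proof. by have [b [ab _]] := omega1_gt2 a a; exists b. Qed.

Lemma omega1_succ a : exists2 b, lt a b & forall c, lt c b -> le c a.
Proof.
have [b ab b_min] := has_least (omega1_gt a); exists b => // c cb.
by apply: not_lt => /b_min; apply: lt_nge.
Qed.

Lemma omega1_tail_enumeration a : exists f : W -> W,
  [/\ forall b c, lt b c -> lt (f b) (f c), forall b, le a (f b) &
      forall c, le a c -> exists b, f b = c].
Proof.
pose Phi d (f : W -> W) x := [/\ le a x, forall b, lt b d -> lt (f b) x &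
  forall y, le a y -> (forall b, lt b d -> lt (f b) y) -> le x y].
have [|d f f' x ff' [ax fx x_min]|d f _|f fP] :=
  @well_founded_choice W W (@lt W) a Phi lt_wf.
- exact: lt_trans.
- split=> // [b bd|y ay f'y]; first by rewrite -ff' //; apply: fx.
  by apply: x_min => // b bd; rewrite ff' //; apply: f'y.
- have [c fc] := countable_bounded f (countable_lt d).
  have [e [ae ce]] := omega1_gt2 a c.
  have [|x [ax fx] x_min] := has_least (X := [set x | le a x /\
    forall b, lt b d -> lt (f b) x]).
    exists e; split; first by right.
    by move=> b /fc fbc; apply: lt_trans ce.
  by exists x; split=> // y ay fy; apply: x_min.
have f_incr b c : lt b c -> lt (f b) (f c).
  by move=> bc; case: (fP c) => _ fc _; apply: fc.
exists f; split=> // [b|c ac]; first by case: (fP b).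
have [|d cfd d_min] := has_least (X := [set d | le c (f d)]).
  by exists c; apply: increasing_ge.
exists d; apply: le_anti => //; case: (fP d) => _ _; apply=> [//|b bd].
by apply: not_le => cfb; apply: lt_nge bd (d_min b cfb).
Qed.

Lemma omega1_injection_pairs : exists e : W * nat -> W, injective e.
Proof.
have [a0 _] := omega1_inhabited.
pose Phi d (h : W -> nat -> W) (x : nat -> W) :=
  injective x /\ forall b m n, lt b d -> h b m <> x n.
have [|d h h' x hh' [x_inj hx]|d h _|h hP] :=
  @well_founded_choice W _ (@lt W) (fun=> a0) Phi lt_wf.
- exact: lt_trans.
- by split=> // b m n bd; rewrite -hh' //; apply: hx.
- pose used := (fun y => h y.1 y.2) @` ([set b | lt b d] `*` [set: nat]).
  have used_countable : countable used.
    apply/countable_image/countableX; first exact: countable_lt.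
    exact: countableP.
  have /infinite_injection [x x_inj x_new] : infinite_set (~` used).
    move=> /finite_set_countable fin; apply: omega1_uncountable.
    by rewrite -(setUv used); apply: countable_setU.
  by exists x; split=> // b m n bd hbm; apply: (x_new n); exists (b, m).
have h_neq b b' m n : lt b b' -> h b m <> h b' n.
  by move=> bb'; case: (hP b') => _; apply.
exists (fun y => h y.1 y.2) => -[b m] [b' n] /= hbb'.
have [[eb|bb']|b'b] := le_total b b'.
- by move: hbb'; rewrite eb => /(hP b').1 ->.
- by case: (h_neq _ _ _ _ bb' hbb').
by case: (h_neq _ _ _ _ b'b (esym hbb')).
Qed.

Definition closure_points (H : W -> W) a : set W :=
  [set d | lt a d /\ forall b, lt b d -> lt (H b) d].

Lemma closed_closure_points (H : W -> W) a :
  Defs.closed W (closure_points H a).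
Proof.
move=> d [b0 b0d] limd; split.
  by have [c [_ [cd [ac _]]]] := limd b0 b0d; apply: lt_trans cd.
move=> b bd; have [c [bc [cd [_ Hc]]]] := limd b bd.
by apply: lt_trans cd; apply: Hc.
Qed.

Lemma unbounded_closure_points (H : W -> W) a :
  unbounded W (closure_points H a).
Proof.
move=> b0.
have /choice [s sP] : forall c, exists x,
    [/\ lt a x, lt c x & forall b, le b c -> lt (H b) x].
  move=> c; have [d [ad cd]] := omega1_gt2 a c.
  have [e He] := countable_bounded H (countable_le c).
  have [x [dx ex]] := omega1_gt2 d e; exists x.
  split=> [||b /He Hb]; by [apply: lt_trans dx|apply: lt_trans ex].
pose u n := iter n.+1 s b0.
have [|d ud d_min] := has_least (X := [set d | forall n, lt (u n) d]).
  have [d ud] := countable_bounded u (countableP setT).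
  by exists d => n; apply: ud.
have [as0 b0s _] := sP b0.
exists d; split; first exact: lt_trans (ud 0).
split=> [|b bd]; first exact: lt_trans (ud 0).
have [n bun] : exists n, le b (u n).
  apply: contrapT => nb; apply: (lt_nge bd); apply: d_min => n.
  by apply: not_le => bun; apply: nb; exists n.
by have [_ _ /(_ b bun) Hb] := sP (u n); apply: lt_trans (ud n.+1).
Qed.

End Omega1.

(** * Diamond guesses subsets of a countably filtered set *)

Record countable_filtration (W : ordset) (A : Type) (X : W -> set A) : Prop :=
  CountableFiltration {
    countable_stage : forall b, countable (X b);
    stage_exhaustive : forall x, exists b, X b x
  }.

Section Filtration.
Context {W : ordset} {oW : omega1 W} {A : Type}.
Variable X : W -> set A.
Hypothesis filtX : countable_filtration X.
Implicit Types (a b c d : W) (x y : A).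

Definition stages_below d : set A := [set x | exists2 b, lt b d & X b x].

Lemma filtration_injection : exists e : A -> W, injective e.
Proof.
have [e e_inj] := omega1_injection_pairs.
have /choice [r Xr] := stage_exhaustive filtX.
have /choice [f f_inj] : forall b, exists f : A -> nat,
    forall x y, X b x -> X b y -> f x = f y -> x = y.
  by move=> b; apply/countable_injectionP/countable_stage.
exists (fun x => e (r x, f (r x) x)) => x y /e_inj [rxy fxy].
by move: fxy (Xr y); rewrite -rxy => fxy Xy; apply: f_inj fxy.
Qed.

Lemma filtration_reflects (R : A -> A -> Prop) : exists H : W -> W, forall d,
  (forall b, lt b d -> lt (H b) d) ->
  forall x, stages_below d x -> (exists y, R x y) ->
  exists2 y, R x y & stages_below d y.
Proof.
have /choice [w wP] : forall x, exists y, (exists z, R x z) -> R x y.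
  move=> x; have [[y Rxy]|] := pselect (exists y, R x y); first by exists y.
  by exists x.
have /choice [r Xr] := stage_exhaustive filtX.
have /choice [H HP] : forall b, exists c, forall x, X b x -> lt (r (w x)) c.
  by move=> b; apply/countable_bounded/countable_stage.
exists H => d Hd x [b bd Xbx] /wP Rxw; exists (w x) => //.
by exists (r (w x)) => //; apply: lt_trans (Hd b bd); apply: HP.
Qed.

Definition guesses (E : W -> set A) : Prop :=
  forall (B : set A) (H : W -> W) a, exists d,
    [/\ lt a d, forall b, lt b d -> lt (H b) d &
        forall x, stages_below d x -> (B x <-> E d x)].

Lemma diamond_guesses : diamond W -> exists E, guesses E.
Proof.
case=> D [_ D_guess]; have [e e_inj] := filtration_injection.
exists (fun d x => D d (e x)) => B H a.
have /choice [H' H'P] : forall b, exists c,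
    lt (H b) c /\ forall x, X b x -> lt (e x) c.
  move=> b; have [c ec] := countable_bounded e (countable_stage filtX b).
  have [c' [cc' Hc']] := omega1_gt2 c (H b).
  by exists c'; split=> // x /ec ex; apply: lt_trans cc'.
have [d [[ad H'd] Dd]] := D_guess (e @` B) _
  (@closed_closure_points W _ H' a) (@unbounded_closure_points W _ H' a).
exists d; split=> // [b bd|x [b bd Xbx]].
  by apply: lt_trans (H'd b bd); case: (H'P b).
have ed : lt (e x) d by apply: lt_trans (H'd b bd); apply: (H'P b).2.
split=> [Bx|/Dd [[y By /e_inj <-] //]].
by apply/Dd; split=> //; exists x.
Qed.

End Filtration.

Lemma node_seq_filtration (W : ordset) {oW : omega1 W} :
  countable_filtration
    (fun b => [set s : seq (W * nat) | all (mem [set x | le x.1 b]) s]).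
Proof.
split=> [b|s].
  apply: countable_seqs; apply: countable_subset (countableX (countable_le b)
    (countableP [set: nat])).
  by move=> x xb; split.
elim: s => [|x s [b sb]].
  by have [b _] := @omega1_inhabited W _; exists b.
have [c [xc bc]] := omega1_gt2 x.1 b; exists c; apply/andP; split.
  by rewrite /= inE; right.
apply: sub_all sb => y; rewrite /= !inE => yb.
by right; apply: le_lt_trans bc.
Qed.

(** * Trees *)

Class tree_order (S : ordset) : Prop := TreeOrder {
  tree_strict :: strict_order S;
  lt_linear : forall s t u : S, lt s u -> lt t u -> le s t \/ lt t s
}.

Definition incomp (S : ordset) (s t : S) : Prop := ~ le s t /\ ~ le t s.

Lemma incomp_sym (S : ordset) (s t : S) : incomp s t -> incomp t s.
Proof. by case. Qed.

Definition tuple_le (I : Type) (S : ordset) (q r : I -> S) : Prop :=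
  forall i, le (q i) (r i).

Definition pairwise_incomp (I : Type) (S : ordset) (q : I -> S) : Prop :=
  forall i j, i <> j -> incomp (q i) (q j).

Definition update (I : eqType) (A : Type) (q : I -> A) (i : I) (x : A) :
    I -> A :=
  fun j => if j == i then x else q j.

Lemma update_eq (I : eqType) (A : Type) (q : I -> A) (i : I) (x : A) :
  update q i x i = x.
Proof. by rewrite /update eqxx. Qed.

Lemma update_neq (I : eqType) (A : Type) (q : I -> A) (i j : I) (x : A) :
  j <> i -> update q i x j = q j.
Proof. by rewrite /update => /eqP/negPf ->. Qed.

Section TreeOrder.
Context {S : ordset} {treeS : tree_order S}.
Implicit Types (s t u : S).

Lemma le_linear s t u : le s u -> le t u -> le s t \/ lt t s.
Proof.
case=> [->|su] [->|tu]; [by left|by right|by left; right|].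
exact: (lt_linear su tu).
Qed.

Lemma incomp_not_below s t u : incomp s t -> le s u -> ~ le t u.
Proof.
move=> [nst nts] su tu; case: (le_linear su tu) => // ts.
by apply: nts; right.
Qed.

Lemma incomp_mono s t s' t' : le s s' -> le t t' -> incomp s t -> incomp s' t'.
Proof.
move=> ss tt st; split=> st'.
  exact: incomp_not_below st (le_trans ss st') tt.
exact: incomp_not_below (incomp_sym st) (le_trans tt st') ss.
Qed.

Lemma tuple_le_refl (I : Type) (q : I -> S) : tuple_le q q.
Proof. by []. Qed.

Lemma tuple_le_trans (I : Type) (r q s : I -> S) :
  tuple_le q r -> tuple_le r s -> tuple_le q s.
Proof. by move=> qr rs i; apply: le_trans (qr i) (rs i). Qed.

Lemma update_le (I : eqType) (q : I -> S) (i : I) s :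
  le (q i) s -> tuple_le q (update q i s).
Proof. by move=> qs j; rewrite /update; case: eqP => [->|]. Qed.

End TreeOrder.

(** * Construction of the tree *)

Lemma rasiowa_sikorski (Q : Type) (V : set Q) (R : Q -> Q -> Prop)
    (K : countType) (D : K -> set Q) :
  (forall q, R q q) -> (forall b a c, R a b -> R b c -> R a c) ->
  (forall k q, V q -> exists r, [/\ V r, R q r & D k r]) ->
  forall q, V q -> exists u : nat -> Q,
    [/\ u 0 = q, forall n, V (u n), forall m n, m <= n -> R (u m) (u n) &
        forall k, exists n, D k (u n)].
Proof.
move=> R_refl R_trans dense q0 Vq0.
have /choice [s sP] : forall x : nat * Q, exists r,
    V x.2 -> [/\ V r, R x.2 r & forall k, pickle k = x.1 -> D k r].
  move=> [n q] /=; have [Vq|] := pselect (V q); last by exists q.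
  have [[k <-]|nk] := pselect (exists k : K, pickle k = n).
    have [r [Vr qr Dr]] := dense k q Vq; exists r; split=> //.
    by move=> k' /(pcan_inj pickleK) ->.
  by exists q; split=> // k kn; case: nk; exists k.
pose u := fix u n := if n is m.+1 then s (m, u m) else q0.
have Vu n : V (u n) by elim: n => //= n /(sP (n, u n)) [].
exists u; split=> //.
  by apply: homo_leq => // n; case: (sP (n, u n) (Vu n)).
move=> k; exists (pickle k).+1.
by case: (sP (pickle k, u (pickle k)) (Vu _)) => _ _; apply.
Qed.

Lemma countable_enumeration (A : Type) (X : set A) :
  countable X -> (exists x, X x) ->
  exists2 e : nat -> A, (forall n, X (e n)) &
    forall x, X x -> exists n, e n = x.
Proof.
move=> /countable_injectionP [f f_inj] [x0 Xx0].
have /choice [e eP] : forall n, exists x,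
    X x /\ forall y, X y -> f y = n -> y = x.
  move=> n; have [[x [Xx <-]]|nx] := pselect (exists x, X x /\ f x = n).
    by exists x; split=> // y Xy; apply: f_inj.
  by exists x0; split=> // y Xy fy; case: nx; exists y.
exists e => [n|x Xx]; first by case: (eP n).
by exists (f x); rewrite [RHS]((eP (f x)).2 x).
Qed.

Definition history (W : ordset) := W -> nat -> W -> nat.

(* The node [(d, j)] is the [j]-th node of level [d], and [h d j a] is the index of
   its predecessor at level [a]. Comparing whole branches makes this a tree order
   for every [h], coherent or not. *)
Definition tree (W : ordset) (h : history W) : ordset :=
  Ordset (W * nat) (fun s t => [/\ lt s.1 t.1, h t.1 t.2 s.1 = s.2 &
    forall a, lt a s.1 -> h t.1 t.2 a = h s.1 s.2 a]).

Definition limit_point (W : ordset) (d : W) : Prop :=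
  (exists b, lt b d) /\ forall b, lt b d -> exists2 c, lt b c & lt c d.

Section TreeOfHistory.
Context {W : ordset} {woW : well_order W} (h : history W).

#[export] Instance tree_is_strict_order : strict_order (tree h).
Proof.
split=> [s [/lt_irr] //|t s u [st est bst] [tu etu btu]].
split; [exact: lt_trans tu|by rewrite btu|].
by move=> a au; rewrite btu ?bst //; apply: lt_trans st.
Qed.

Lemma tree_le_level (s t : tree h) : le s t -> le s.1 t.1.
Proof. by case=> [->|[]]; [left|right]. Qed.

Lemma tree_restriction_stable (s t : tree h) (a : W) :
  le s t -> lt a s.1 -> h t.1 t.2 a = h s.1 s.2 a.
Proof. by case=> [-> //|[_ _]]; apply. Qed.

Lemma tree_same_level_eq (s t u : tree h) :
  le s u -> le t u -> s.1 = t.1 -> s = t.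
Proof.
case: s t => [a i] [b j] /= su + ab; rewrite -{b}ab.
case: su => [<-|[au /= ui _]] [ju|[au' /= uj _]] //.
- by case/lt_irr: au'.
- by move: au; rewrite -ju => /lt_irr.
by rewrite -ui -uj.
Qed.

#[export] Instance tree_is_tree_order : tree_order (tree h).
Proof.
split; first exact: tree_is_strict_order.
move=> s t u su tu; have [[st|st]|ts] := le_total s.1 t.1.
- by left; left; apply: (@tree_same_level_eq _ _ u) => //; right.
- left; right; case: su tu => _ us su [_ ut tu].
  split=> // [|a a_s]; first by rewrite -tu.
  by rewrite -tu ?su //; apply: lt_trans st.
- right; case: su tu => _ us su [_ ut tu].
  split=> // [|a a_t]; first by rewrite -su.
  by rewrite -su ?tu //; apply: lt_trans ts.
Qed.

End TreeOfHistory.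

Lemma tree_le_congr (W : ordset) {soW : strict_order W} (h h' : history W)
    (d : W) (s t : W * nat) :
  (forall b, lt b d -> h b = h' b) -> lt t.1 d ->
  @le (tree h) s t -> @le (tree h') s t.
Proof.
move=> hh' td [->|[st ht bt]]; first by left.
have sd : lt s.1 d by apply: lt_trans td.
right; split=> // [|a a_s]; first by rewrite -hh'.
by rewrite -(hh' _ td) -(hh' _ sd) bt.
Qed.

Section Levels.
Context {W : ordset} {oW : omega1 W}.
Variable E : W -> set (seq (W * nat)).
Implicit Types (a b c d : W) (h : history W).

Definition nodes_below h d (q : nat -> tree h) : Prop := forall j, lt (q j).1 d.

Definition settles h d (js : seq nat) (q : nat -> tree h) : Prop :=
  E d (map q js) \/
  forall r, tuple_le q r -> nodes_below d r -> ~ E d (map r js).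

(* [x j] is the branch below the [j]-th node of level [d]. *)
Record level d h (x : nat -> W -> nat) : Prop := Level {
  level_coherent : forall j a b, lt a b -> lt b d -> h b (x j b) a = x j a;
  level_extends : forall s : tree h, lt s.1 d -> exists j, x j s.1 = s.2;
  level_splits : forall s : tree h, lt s.1 d ->
    (forall c, lt c d -> le c s.1) ->
    exists j j', [/\ j <> j', x j s.1 = s.2 & x j' s.1 = s.2];
  level_separates : limit_point d -> forall j j', j <> j' ->
    exists2 a, lt a d & x j a <> x j' a;
  level_generic : limit_point d -> forall js, exists s : nat -> tree h,
    [/\ nodes_below d s, forall j, x j (s j).1 = (s j).2 & settles d js s]
}.

Lemma level_congr d h h' (x : nat -> W -> nat) :
  (forall b, lt b d -> h b = h' b) -> level d h x -> level d h' x.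
Proof.
move=> hh' [coh ext spl sep gen]; split=> //.
  by move=> j a b ab bd; rewrite -hh' //; apply: coh.
move=> ld js; have [s [sd xs Es]] := gen ld js; exists s; split=> //.
case: Es => [Es|noE]; [by left|right] => r sr rd; apply: noE => // j.
by apply: tree_le_congr (sr j) => [b bd|]; [rewrite hh'|apply: rd].
Qed.

Section Below.
Variable h : history W.
Implicit Types (s t : tree h) (q : nat -> tree h).

Definition good_level d : Prop := level d h (h d).

Lemma tree_lt_restriction s t :
  good_level t.1 -> lt s.1 t.1 -> h t.1 t.2 s.1 = s.2 -> lt s t.
Proof.
move=> gt st ts; split=> // a a_s.
by rewrite -ts (level_coherent gt).
Qed.

Lemma tree_extend s b : good_level b -> lt s.1 b -> exists2 t, lt s t & t.1 = b.
Proof.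
move=> gb sb; have [j hj] := level_extends gb sb.
by exists (b, j) => //; apply: tree_lt_restriction.
Qed.

Lemma tree_extend_le s b :
  good_level b -> le s.1 b -> exists2 t, le s t & t.1 = b.
Proof.
move=> gb [sb|/(tree_extend gb) [t st tb]]; first by exists s.
by exists t => //; right.
Qed.

Lemma tree_split s b :
  good_level b -> lt s.1 b -> (forall c, lt c b -> le c s.1) ->
  exists t t', [/\ t <> t', t.1 = b, t'.1 = b, lt s t & lt s t'].
Proof.
move=> gb sb b_min; have [j [j' [jj' hj hj']]] := level_splits gb sb b_min.
exists (b, j), (b, j'); split=> //; try exact: tree_lt_restriction.
by case.
Qed.

Lemma tree_same_level_incomp s t : s.1 = t.1 -> s <> t -> incomp s t.
Proof.
move=> lev_st st; split=> le_st; apply: st.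
  exact: tree_same_level_eq le_st (le_refl t) lev_st.
by apply/esym; apply: tree_same_level_eq le_st (le_refl s) (esym lev_st).
Qed.

Section Limit.
Variable d : W.
Hypothesis limd : limit_point d.
Hypothesis good_below : forall b, lt b d -> good_level b.

Lemma succ_below_limit b : lt b d ->
  exists c, [/\ lt b c, lt c d & forall a, lt a c -> le a b].
Proof.
move=> bd; have [c bc c_min] := omega1_succ b; exists c; split=> //.
have [a ba ad] := limd.2 b bd.
by apply: le_lt_trans ad; apply: not_lt => /c_min /(lt_nge ba).
Qed.

Lemma incomp_dense_below s t : lt s.1 d -> lt t.1 d ->
  exists s' t', [/\ le s s', le t t', lt s'.1 d, lt t'.1 d & incomp s' t'].
Proof.
move=> sd td.
have [b [sb tb bd]] : exists b, [/\ le s.1 b, le t.1 b & lt b d].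
  have [st|ts] := le_total s.1 t.1; first by exists t.1.
  by exists s.1; split=> //; right.
have [c [bc cd c_min]] := succ_below_limit bd.
have [s1 ss1 s1b] := tree_extend_le (good_below bd) sb.
have [t1 tt1 t1c] := tree_extend (good_below cd) (le_lt_trans tb bc).
have [||u [v [uv uc vc s1u s1v]]] := tree_split (s := s1) (good_below cd).
- by rewrite s1b.
- by rewrite s1b.
have [w [s1w wc wt1]] : exists w, [/\ lt s1 w, w.1 = c & w <> t1].
  have [ut1|] := pselect (u = t1); last by exists u.
  by exists v; split=> // vt1; apply: uv; rewrite ut1.
exists w, t1; rewrite wc t1c; split=> //.
- by right; apply: le_lt_trans s1w.
- by right.
by apply: tree_same_level_incomp; rewrite ?wc ?t1c.
Qed.

Lemma update_below q i s :
  nodes_below d q -> lt s.1 d -> nodes_below d (update q i s).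
Proof. by move=> qd sd j; rewrite /update; case: eqP. Qed.

Lemma raising_dense q i b : nodes_below d q -> lt b d ->
  exists r, [/\ nodes_below d r, tuple_le q r & lt b (r i).1].
Proof.
move=> qd bd.
have [c [qc bc cd]] : exists c, [/\ le (q i).1 c, lt b c & lt c d].
  have [qb|bq] := le_total (q i).1 b; last by exists (q i).1.
  have [c bc cd] := limd.2 b bd.
  by exists c; split=> //; right; apply: le_lt_trans bc.
have [s qs sc] := tree_extend_le (good_below cd) qc.
exists (update q i s); split; first by apply: update_below; rewrite ?sc.
  exact: update_le.
by rewrite update_eq sc.
Qed.

Lemma separating_dense q i j : i <> j -> nodes_below d q ->
  exists r, [/\ nodes_below d r, tuple_le q r & incomp (r i) (r j)].
Proof.
move=> ij qd.
have [s [t [qs qt sd td st]]] := incomp_dense_below (qd i) (qd j).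
exists (update (update q i s) j t); split.
- by apply: update_below => //; apply: update_below.
- apply: tuple_le_trans (update_le qs) _; apply: update_le.
  by rewrite update_neq //; apply: nesym.
by rewrite update_eq update_neq // update_eq.
Qed.

Lemma settling_dense q js : nodes_below d q ->
  exists r, [/\ nodes_below d r, tuple_le q r & settles d js r].
Proof.
move=> qd.
have [[r [qr rd Er]]|nr] := pselect (exists r : nat -> tree h,
    [/\ tuple_le q r, nodes_below d r & E d (map r js)]).
  by exists r; split=> //; left.
exists q; split=> //; right=> r qr rd Er.
by apply: nr; exists r.
Qed.

Record generic_sequence (u : nat -> nat -> tree h) : Prop := GenericSequence {
  generic_below : forall n, nodes_below d (u n);
  generic_mono : forall m n, m <= n -> tuple_le (u m) (u n);
  generic_extends : forall s, lt s.1 d -> exists i, u 0 i = s;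
  generic_cofinal : forall i b, lt b d -> exists n, lt b (u n i).1;
  generic_incomp : forall i j, i <> j -> exists n, incomp (u n i) (u n j);
  generic_settles : forall js, exists n, settles d js (u n)
}.

Lemma generic_sequence_exists : exists u, generic_sequence u.
Proof.
have [b0 b0d] := limd.1.
have [|e ed e_onto] := countable_enumeration
  (countableX (countable_lt d) (countableP [set: nat])).
  by exists (b0, 0).
pose D (k : nat * nat + nat * nat + seq nat) (q : nat -> tree h) : Prop :=
  match k with
  | inl (inl (i, n)) => lt (e n).1 (q i).1
  | inl (inr (i, j)) => i <> j -> incomp (q i) (q j)
  | inr js => settles d js q
  end.
have [|||i|u [u0 ud u_mono uD]] := rasiowa_sikorski (Q := nat -> tree h)
  (V := nodes_below d) (R := @tuple_le nat (tree h)) (D := D) _ _ _ (q := e).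
- exact: tuple_le_refl.
- exact: tuple_le_trans.
- move=> [[[i n]|[i j]]|js] q qd; last exact: settling_dense.
    by apply: raising_dense => //; case: (ed n).
  have [ij|nij] := pselect (i <> j); last first.
    by exists q; split=> // [|/nij //]; apply: tuple_le_refl.
  by have [r [rd qr rij]] := separating_dense ij qd; exists r; split=> // _.
- by case: (ed i).
exists u; split=> //.
- by move=> s sd; rewrite u0; apply: e_onto.
- move=> i b bd; have [n en] := e_onto (b, 0) (conj bd I).
  by have [m] := uD (inl (inl (i, n))); rewrite /= en; exists m.
- by move=> i j ij; have [n un] := uD (inl (inr (i, j))); exists n; apply: un.
by move=> js; apply: (uD (inr js)).
Qed.

Section LimitBranches.
Variable u : nat -> nat -> tree h.
Hypothesis gen_u : generic_sequence u.

Lemma limit_branches_exist : exists x : nat -> W -> nat,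
  forall i n a, lt a (u n i).1 -> x i a = h (u n i).1 (u n i).2 a.
Proof.
have /choice [x xP] : forall y : nat * W, exists k, forall n,
    lt y.2 (u n y.1).1 -> k = h (u n y.1).1 (u n y.1).2 y.2.
  move=> [i a] /=.
  have [[m am]|nm] := pselect (exists m, lt a (u m i).1); last first.
    by exists 0 => n an; case: nm; exists n.
  exists (h (u m i).1 (u m i).2 a) => n an.
  have [mn|nm] := leqP m n.
    by rewrite (tree_restriction_stable (generic_mono gen_u mn i) am).
  by rewrite (tree_restriction_stable (generic_mono gen_u (ltnW nm) i) an).
by exists (fun i a => x (i, a)) => i n a; apply: (xP (i, a)).
Qed.

Variable x : nat -> W -> nat.
Hypothesis x_branch :
  forall i n a, lt a (u n i).1 -> x i a = h (u n i).1 (u n i).2 a.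

Lemma limit_branch_through i n : x i (u n i).1 = (u n i).2.
Proof.
have [m nm] := generic_cofinal gen_u i (generic_below gen_u n i).
have [mn|/ltnW /(generic_mono gen_u) /(_ i) [e|[_ unm _]]] := leqP m n.
- case: (lt_nge nm); apply: tree_le_level; exact: generic_mono gen_u _ _ mn i.
- by move: nm; rewrite e => /lt_irr.
by rewrite (x_branch nm).
Qed.

Lemma limit_branch_le i j n : (forall a, lt a d -> x i a = x j a) ->
  le (u n i).1 (u n j).1 -> le (u n i) (u n j).
Proof.
move=> xij; have through := limit_branch_through i n.
rewrite xij in through; last exact: generic_below.
case=> [ij|ij].
  left; rewrite [LHS]surjective_pairing -through ij limit_branch_through.
  by rewrite -surjective_pairing.
right; apply: tree_lt_restriction => //; first exact/good_below/generic_below.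
by rewrite -(x_branch ij).
Qed.

Lemma limit_branches_separated i j :
  i <> j -> exists2 a, lt a d & x i a <> x j a.
Proof.
move=> /(generic_incomp gen_u) [n [nij nji]]; apply: contrapT => same.
have xij a : lt a d -> x i a = x j a.
  by move=> ad; apply: contrapT => ne; apply: same; exists a.
have [ij|ji] := le_total (u n i).1 (u n j).1; first exact/nij/limit_branch_le.
by apply/nji/limit_branch_le; [move=> a /xij|right].
Qed.

Lemma limit_branches_level : level d h x.
Proof.
split.
- move=> j a b ab bd; have [n bn] := generic_cofinal gen_u j bd.
  rewrite !(x_branch (n := n)) //; last exact: lt_trans bn.
  by apply: (level_coherent (good_below (generic_below gen_u n j)) _ ab bn).
- move=> s sd; have [i ui] := generic_extends gen_u sd.
  by exists i; rewrite -ui limit_branch_through.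
- move=> s sd s_max; have [c sc cd] := limd.2 s.1 sd.
  by case: (lt_nge sc (s_max c cd)).
- by move=> _; apply: limit_branches_separated.
move=> _ js; have [n un] := generic_settles gen_u js.
exists (u n); split=> // [|j]; first exact: generic_below.
exact: limit_branch_through.
Qed.

End LimitBranches.

Lemma limit_level_exists : exists x, level d h x.
Proof.
have [u gen_u] := generic_sequence_exists.
have [x x_branch] := limit_branches_exist gen_u.
by exists x; apply: limit_branches_level x_branch.
Qed.

End Limit.

Lemma base_level d : (forall b, ~ lt b d) -> level d h (fun _ _ => 0).
Proof.
move=> d0; split.
- by move=> j a b _ /d0.
- by move=> s /d0.
- by move=> s /d0.
- by case=> -[b /d0].
by case=> -[b /d0].
Qed.

Definition doubled_branches b (j : nat) a : nat :=
  if pselect (a = b) then j./2 else h b j./2 a.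

Lemma succ_level b d : good_level b -> lt b d -> (forall c, lt c d -> le c b) ->
  level d h (doubled_branches b).
Proof.
move=> gb bd b_max.
have at_top j : doubled_branches b j b = j./2.
  by rewrite /doubled_branches; case: pselect.
have below j a : lt a b -> doubled_branches b j a = h b j./2 a.
  by rewrite /doubled_branches => /lt_neq; case: pselect.
have nlimd : ~ limit_point d.
  by case=> _ /(_ b bd) [c bc cd]; apply: lt_nge bc (b_max c cd).
split=> //.
- move=> j a c ac cd.
  have ab : lt a b by apply: lt_le_trans (b_max c cd).
  case: (b_max c cd) => [->|cb]; first by rewrite at_top below.
  by rewrite !below //; apply: (level_coherent gb).
- move=> s sd; case: (b_max s.1 sd) => [->|sb].
    by exists s.2.*2; rewrite at_top doubleK.
  have [j hj] := level_extends gb sb.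
  by exists j.*2; rewrite below // doubleK.
move=> s sd s_max.
have -> : s.1 = b by apply: le_anti; [apply: b_max|apply: s_max].
exists s.2.*2, s.2.*2.+1; rewrite !at_top doubleK /= uphalf_double.
by split=> //; apply/n_Sn.
Qed.

End Below.

Lemma level_exists d h :
  (forall b, lt b d -> good_level h b) -> exists x, level d h x.
Proof.
move=> gd; have [ld|nld] := pselect (limit_point d).
  exact: limit_level_exists.
have [ex|nex] := pselect (exists b, lt b d); last first.
  by exists (fun _ _ => 0); apply: base_level => b bd; apply: nex; exists b.
have [b bd b_max] : exists2 b, lt b d & forall c, lt c d -> le c b.
  apply: contrapT => nb; apply: nld; split=> // b bd; apply: contrapT => nc.
  apply: nb; exists b => // c cd; apply: not_lt => bc.
  by apply: nc; exists c.
by exists (doubled_branches h b); apply: succ_level => //; apply: gd.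
Qed.

Lemma good_history_exists : exists h, forall d, good_level h d.
Proof.
have [|||h gh] := @well_founded_choice W _ (@lt W) (fun _ _ => 0) level lt_wf.
- exact: lt_trans.
- exact: level_congr.
- by move=> d h; apply: level_exists.
by exists h.
Qed.

End Levels.

(** * Free forests *)

Definition decides (I : Type) (S : ordset) (D : set (I -> S)) (t : I -> S) :
    Prop :=
  (exists2 s, tuple_le s t & D s) \/ (forall s, tuple_le t s -> ~ D s).

Section Levelled.
Context {W S : ordset} (lev : S -> W).

Definition levels_above (I : Type) (a : W) (t : I -> S) : Prop :=
  forall i, le a (lev (t i)).

Definition separated_at (I : Type) (a : W) (t : I -> S) : Prop :=
  forall i j, i <> j -> forall u, le u (t i) -> le u (t j) -> lt (lev u) a.

Class normal_forest : Prop := NormalForest {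
  forest_tree_order :: tree_order S;
  lev_lt : forall s t : S, lt s t -> lt (lev s) (lev t);
  lev_restrict : forall (t : S) b,
    lt b (lev t) -> exists2 u, lt u t & lev u = b;
  lev_extend : forall (t : S) b,
    lt (lev t) b -> exists2 s, lt t s & lev s = b;
  countable_level : forall a, countable [set t | lev t = a];
  level_inhabited : forall a, exists t, lev t = a;
  forest_splits : forall s : S, exists t t', [/\ t <> t',
    immediate_succ ground S s t & immediate_succ ground S s t'];
  limit_unique : forall s t : S, limit_point (lev s) -> lev s = lev t ->
    (forall u, lt u s <-> lt u t) -> s = t
}.

(* Freeness is the combinatorial form of "finite products of cones above pairwise
   incomparable nodes are ccc". *)
Class free_forest : Prop := FreeForest {
  free_forest_normal :: normal_forest;
  freeness : forall (I : finType) (D : set (I -> S)) b, exists2 a, le b a &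
    forall t, levels_above a t -> separated_at a t -> decides D t
}.

End Levelled.

(* A normal forest may have many roots, its cones have one. *)
Definition rooted (S : ordset) : Prop :=
  forall s t : S, (forall u, ~ lt u s) -> (forall u, ~ lt u t) -> s = t.

Section Forest.
Context {W S : ordset} {oW : omega1 W} {lev : S -> W} {nS : normal_forest lev}.
Implicit Types (a b : W) (s t u : S).

Lemma lev_le s t : le s t -> le (lev s) (lev t).
Proof. by case=> [->|/lev_lt]; [left|right]. Qed.

Lemma le_of_lev s t u : le s u -> le t u -> le (lev s) (lev t) -> le s t.
Proof. by move=> su tu st; case: (le_linear su tu) => // /lev_lt /lt_nge. Qed.

Lemma lt_of_lev s t u : le s u -> le t u -> lt (lev s) (lev t) -> lt s t.
Proof.
by move=> su tu st; case: (le_linear tu su) => // /lev_le /(lt_nge st).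
Qed.

Lemma eq_of_lev s t u : le s u -> le t u -> lev s = lev t -> s = t.
Proof.
move=> su tu st.
by apply: le_anti; [apply: le_of_lev tu _|apply: le_of_lev su _]; rewrite // st.
Qed.

Lemma restrict_le t a : le a (lev t) -> exists2 u, le u t & lev u = a.
Proof.
case=> [->|/lev_restrict [u ut ua]]; first by exists t.
by exists u => //; right.
Qed.

Lemma extend_le t a : le (lev t) a -> exists2 s, le t s & lev s = a.
Proof.
by case=> [<-|/lev_extend [s ts sa]]; [exists t|exists s => //; right].
Qed.

Lemma extend_above t a : exists2 s, le t s & le a (lev s).
Proof.
have [ta|/lev_extend [s ts <-]] := le_total a (lev t); first by exists t.
by exists s => //; right.
Qed.

Lemma countable_levels_le a : countable [set t | le (lev t) a].
Proof.
apply: countable_subset (bigcup_countable (countable_le a)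
  (fun b _ => countable_level b)).
by move=> t ta; exists (lev t).
Qed.

Lemma forest_wf : well_founded (@lt S).
Proof.
suff acc a : forall t, lev t = a -> Acc (@lt S) t by move=> t; apply: acc erefl.
elim/(well_founded_ind lt_wf): a => a IH t ta; constructor => s /lev_lt.
by rewrite ta => /IH; apply.
Qed.

Lemma forest_min_below t (Y : set S) : (forall s, Y s -> lt s t) ->
  (exists s, Y s) -> exists2 m, Y m & forall s, Y s -> le m s.
Proof.
move=> Yt [s0 Ys0].
have [|_ [m Ym <-] m_min] := has_least (X := lev @` Y).
  by exists (lev s0), s0.
exists m => // s Ys; apply: (le_of_lev (u := t)); try by right; apply: Yt.
by apply: m_min; exists s.
Qed.

Lemma tuple_filtration (I : finType) : countable_filtration
  (fun b => [set r : I -> S | forall i, le (lev (r i)) b]).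
Proof.
split=> [b|r]; first exact: countable_tuples (countable_levels_le b).
have [b rb] := countable_bounded (lev \o r) (countableP setT).
by exists b => i; right; apply: rb.
Qed.

Lemma rooted_limit_unique (rS : rooted S) s t : is_limit ground W (lev s) ->
  lev s = lev t -> (forall u, lt u s <-> lt u t) -> s = t.
Proof.
move=> lim st same; have [[u us]|ns] := pselect (exists u, lt u s).
  apply: limit_unique => //; split; first by exists (lev u); apply: lev_lt.
  move=> b bs; apply: contrapT => nc; apply: lim; exists b; split=> // c cs.
  by apply: not_lt => bc; apply: nc; exists c.
by apply: rS => u us; apply: ns; exists u => //; apply/same.
Qed.

(* A relation that behaves like a partial isomorphism between predecessors, such as
   "some condition forces f(s) = b", can only relate a node to its level. *)
Lemma back_and_forth_level (F : S -> W -> Prop) :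
  (forall s b u, F s b -> lt u s -> exists2 c, F u c & lt c b) ->
  (forall s b c, F s b -> lt c b -> exists2 u, F u c & lt u s) ->
  forall s b, F s b -> lev s = b.
Proof.
move=> forth back; elim/(well_founded_ind forest_wf) => s IH b Fsb.
have [[//|sb]|/lev_restrict [u us ub]] := le_total (lev s) b.
  have [u Fu us] := back _ _ _ Fsb sb.
  have : lt (lev u) (lev s) by apply: lev_lt.
  by rewrite (IH u us _ Fu) => /lt_irr.
have [c Fuc cb] := forth _ _ _ Fsb us.
by move: cb; rewrite -(IH u us c Fuc) ub => /lt_irr.
Qed.

Lemma immediate_succs_incomp s t t' : immediate_succ ground S s t ->
  immediate_succ ground S s t' -> t <> t' -> incomp t t'.
Proof.
move=> [st no_t] [st' no_t'] tt'; split=> -[e|l]; try exact: tt'.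
  by apply: no_t'; exists t.
by apply: no_t; exists t'.
Qed.

Lemma split_incomp s : exists t t', [/\ lt s t, lt s t' & incomp t t'].
Proof.
have [t [t' [tt' it it']]] := forest_splits s.
have inc := immediate_succs_incomp it it' tt'.
by exists t, t'; split=> //; [case: it|case: it'].
Qed.

Lemma incomp_dense s t : exists s' t', [/\ le s s', le t t' & incomp s' t'].
Proof.
have [st|nst] := pselect (le s t).
  have [u [v [tu tv uv]]] := split_incomp t.
  exists u, v; split=> //; last by right.
  by right; apply: le_lt_trans tu.
have [ts|nts] := pselect (le t s); last by exists s, t.
have [u [v [su sv uv]]] := split_incomp s.
exists u, v; split=> //; first by right.
by right; apply: le_lt_trans sv.
Qed.

Lemma incomp_extend s t : lt s t -> exists2 u, le s u & incomp u t.
Proof.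
move=> st; have [u [v [uv su sv]]] := forest_splits s.
have inc := immediate_succs_incomp su sv uv.
have [ut|nut] := pselect (le u t).
  exists v; first by right; case: sv.
  by apply: incomp_mono ut (incomp_sym inc).
exists u; first by right; case: su.
split=> // -[tu|tu]; first by apply: nut; rewrite tu.
by case: su => _; apply; exists t.
Qed.

Lemma pairwise_incomp_dense (I : finType) (q : I -> S) :
  exists2 r, tuple_le q r & pairwise_incomp r.
Proof.
suff [r qr inc] : exists2 r, tuple_le q r & forall x : I * I,
    x \in enum {: I * I} -> x.1 <> x.2 -> incomp (r x.1) (r x.2).
  by exists r => // i j; apply: (inc (i, j)); rewrite mem_enum.
elim: (enum _) => [|[i j] l [r qr inc]].
  by exists q => //; apply: tuple_le_refl.
have [eij|/eqP ij] := eqVneq i j.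
  by exists r => // x; rewrite in_cons => /orP [/eqP -> /= /(_ eij)|/inc].
have [s [t [rs rt st]]] := incomp_dense (r i) (r j).
have r_le : tuple_le r (update (update r i s) j t).
  apply: tuple_le_trans (update_le rs) _; apply: update_le.
  by rewrite update_neq //; apply: nesym.
exists (update (update r i s) j t); first exact: tuple_le_trans r_le.
move=> x; rewrite in_cons => /orP [/eqP -> _|/inc xP /xP] /=.
  by rewrite update_eq update_neq // update_eq.
exact: incomp_mono.
Qed.

End Forest.

Section Freeness.
Context {W S : ordset} {oW : omega1 W} {lev : S -> W} {fS : free_forest lev}.
Implicit Types (a b : W) (x y : S).

Lemma incomp_decides (I : finType) (q : I -> S) (D : set (I -> S)) b :
  pairwise_incomp q -> exists2 a, le b a &
    forall r, tuple_le q r -> levels_above lev a r -> decides D r.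
Proof.
move=> inc; have [c qc] := countable_bounded (lev \o q) (countableP setT).
have {}qc k : lt (lev (q k)) c by apply: qc.
have [d [bd cd]] := omega1_gt2 b c.
have [a da decD] := freeness (lev := lev) D d.
exists a; first by right; apply: lt_le_trans da.
move=> r qr ra; apply: decD => // i j ij u ui uj; apply: not_le => au.
have qu k : le u (r k) -> le (q k) u.
  move=> uk; apply: le_of_lev (qr k) uk _; right; apply: lt_trans (qc k) _.
  by apply: lt_le_trans au; apply: lt_le_trans da.
apply: incomp_not_below (inc i j ij) (qu i ui) _.
exact: le_trans (qu j uj) _.
Qed.

Lemma incomp_decides_seq (I : finType) (q : I -> S) (D : nat -> set (I -> S)) :
  pairwise_incomp q -> exists a, forall r,
    tuple_le q r -> levels_above lev a r -> forall k, decides (D k) r.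
Proof.
move=> inc; have [b _] := @omega1_inhabited W _.
have /choice [a aP] : forall k, exists a, forall r, tuple_le q r ->
    levels_above lev a r -> decides (D k) r.
  by move=> k; have [a _ aP] := incomp_decides (D k) b inc; exists a.
have [c ac] := countable_bounded a (countableP setT).
exists c => r qr rc k; apply: aP => // i.
by right; apply: lt_le_trans (rc i); apply: ac.
Qed.

Lemma oapp_pairwise_incomp (I : Type) (q : I -> S) x :
  pairwise_incomp q -> (forall i, incomp x (q i)) -> pairwise_incomp (oapp q x).
Proof.
move=> inc xq [i|] [j|] ij //=; last exact/incomp_sym.
by apply: inc => eij; apply: ij; rewrite eij.
Qed.

Lemma oapp_tuple_le (I : Type) (q r : I -> S) x y :
  le x y -> tuple_le q r -> tuple_le (oapp q x) (oapp r y).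
Proof. by move=> xy qr []. Qed.

Lemma incomp_decides_cons (I : finType) (q : I -> S) x
    (D : S -> set (I -> S)) b :
  pairwise_incomp q -> (forall i, incomp x (q i)) -> exists2 a, le b a &
    forall y r, le x y -> tuple_le q r ->
    le a (lev y) -> levels_above lev a r ->
    (exists z s, [/\ le z y, tuple_le s r & D z s]) \/
    (forall z s, le y z -> tuple_le r s -> ~ D z s).
Proof.
move=> inc xq.
have [a ba aP] := @incomp_decides _ (oapp q x)
  (fun z => D (z None) (fun i => z (Some i))) b (oapp_pairwise_incomp inc xq).
exists a => // y r xy qr ya ra.
have above : levels_above lev a (oapp r y) by case.
case: (aP _ (oapp_tuple_le xy qr) above) => [[z zr Dz]|noD].
  left; exists (z None), (fun i => z (Some i)).
  by split; [apply: (zr None)|move=> i; apply: (zr (Some i))|].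
right=> z s yz rs Dzs; apply: (noD (oapp s z)) => //.
exact: oapp_tuple_le.
Qed.

Lemma incomp_decides_cons2 (I : finType) (q : I -> S) x1 x2
    (D : S -> S -> set (I -> S)) b :
  pairwise_incomp q -> incomp x1 x2 -> (forall i, incomp x1 (q i)) ->
  (forall i, incomp x2 (q i)) -> exists2 a, le b a &
    forall y1 y2 r, le x1 y1 -> le x2 y2 -> tuple_le q r ->
    le a (lev y1) -> le a (lev y2) -> levels_above lev a r ->
    (exists z1 z2 s, [/\ le z1 y1, le z2 y2, tuple_le s r & D z1 z2 s]) \/
    (forall z1 z2 s, le y1 z1 -> le y2 z2 -> tuple_le r s -> ~ D z1 z2 s).
Proof.
move=> inc x12 x1q x2q.
have [|i|a ba aP] := @incomp_decides_cons _ (oapp q x2) x1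
  (fun z s => D z (s None) (fun i => s (Some i))) b.
- exact: oapp_pairwise_incomp.
- by case: i.
exists a => // y1 y2 r xy1 xy2 qr ay1 ay2 ar.
have above : levels_above lev a (oapp r y2) by case.
case: (aP _ _ xy1 (oapp_tuple_le xy2 qr) ay1 above) => [[z [s [zy sr Dz]]]|noD].
  left; exists z, (s None), (fun i => s (Some i)).
  by split; [|apply: (sr None)|move=> i; apply: (sr (Some i))|].
right=> z1 z2 s yz1 yz2 rs; apply: (noD z1 (oapp s z2)) => //.
exact: oapp_tuple_le.
Qed.

End Freeness.

(** * Diamond yields a free forest *)

Lemma extend_along_injection (I : finType) (A : Type) (j : I -> nat)
    (w : I -> A) (s : nat -> A) : injective j -> exists2 r : nat -> A,
  forall i, r (j i) = w i &
  forall n, (exists2 i, j i = n & r n = w i) \/ r n = s n.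
Proof.
move=> j_inj.
exists (fun n => if [pick i | j i == n] is Some i then w i else s n).
  by move=> i; case: pickP => [i' /eqP /j_inj -> //|/(_ i)]; rewrite eqxx.
by move=> n; case: pickP => [i /eqP ji|_]; [left; exists i|right].
Qed.

Section GuessedTree.
Context {W : ordset} {oW : omega1 W}.
Variables (E : W -> set (seq (W * nat))) (h : history W).
Hypothesis E_guesses :
  guesses (fun b => [set s | all (mem [set x | le x.1 b]) s]) E.
Hypothesis good_h : forall d, good_level E h d.

#[local] Instance tree_normal_forest : normal_forest (fun t : tree h => t.1).
Proof.
split.
- exact: tree_is_tree_order.
- by move=> s t [].
- move=> t b bt; exists (b, h t.1 t.2 b) => //.
  exact: tree_lt_restriction (good_h _) _ _.
- by move=> t b; apply: tree_extend.
- move=> a; apply: (@countable_inj _ _ _ setT snd) => // -[b i] [c j] /= -> ->.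
  by move->.
- by move=> a; exists (a, 0).
- move=> s; have [b sb b_min] := omega1_succ s.1.
  have [t [t' [tt' tb tb' st st']]] := tree_split (good_h b) sb b_min.
  exists t, t'; split=> //; split=> // -[u [[su _ _] [ut _ _]]].
    by move: ut; rewrite tb => /b_min; apply: lt_nge.
  by move: ut; rewrite tb' => /b_min; apply: lt_nge.
move=> [d i] [_ j] /= limd <- same; congr pair; apply: contrapT => ij.
have [a ad] := level_separates (good_h d) limd ij; apply.
have /same [_ /= ->] // : @lt (tree h) (a, h d i a) (d, i).
exact: tree_lt_restriction (good_h _) _ _.
Qed.

Definition tuple_below (I : Type) d (r : I -> tree h) : Prop :=
  forall i, lt (r i).1 d.

Lemma guessed_reflection (I : finType) (D : set (I -> tree h)) b : exists d,
  [/\ lt b d, limit_point d,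
      forall r, tuple_below d r -> (E d (map r (enum I)) <-> D r) &
      forall r s, tuple_below d r -> tuple_le r s -> D s ->
        exists t, [/\ tuple_below d t, tuple_le r t & D t]].
Proof.
have [H HP] := filtration_reflects (@tuple_filtration W (tree h) _ _ _ I)
  (fun r s => tuple_le r s /\ D s).
have /choice [H' H'P] : forall c, exists c', lt c c' /\ lt (H c) c'.
  by move=> c; apply: omega1_gt2.
have [d [bd H'd Ed]] :=
  E_guesses (fun l => exists2 r, D r & l = map r (enum I)) H' b.
have Hd c : lt c d -> lt (H c) d.
  by move=> cd; apply: lt_trans (H'd c cd); case: (H'P c).
exists d; split=> // [|r rd|r s rd rs Ds].
- split; first by exists b.
  by move=> c cd; exists (H' c); [case: (H'P c)|apply: H'd].
- have [c cd rc] := finite_bounded_below bd rd.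
  rewrite -Ed; last by exists c => //; apply: all_map_enum.
  by split=> [[r' Dr' /map_enum_inj ->] //|Dr]; exists r.
have [c cd rc] := finite_bounded_below bd rd.
have [||t [rt Dt] [c' c'd tc]] := HP d Hd r; [by exists c|by exists s|].
by exists t; split=> // i; apply: le_lt_trans c'd.
Qed.

(* The generic branches of a level [d] as above settle [D] below [d], hence in the
   whole tree. *)
Lemma tree_freeness (I : finType) (D : set (I -> tree h)) b :
  exists2 a, le b a & forall t, levels_above (fun x : tree h => x.1) a t ->
    separated_at (fun x : tree h => x.1) a t -> decides D t.
Proof.
have [d [bd limd Ed D_reflects]] := guessed_reflection D b.
exists d; first by right.
move=> t td sep.
have /choice [j jt] : forall i, exists k, le ((d, k) : tree h) (t i).
  move=> i; have [[a k] ut /= ad] := restrict_le (td i).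
  by exists k; rewrite -ad.
have j_inj : injective j.
  move=> i i' jii'; apply: contrapT => ii'.
  by apply: (@lt_irr W _ d); apply: (sep i i' ii' (d, j i)); rewrite // jii'.
have [s [sd sE settled]] := level_generic (good_h d) limd (map j (enum I)).
have sjd : tuple_below d (s \o j) by move=> i; apply: sd.
have sjt : tuple_le (s \o j) t.
  move=> i; apply: le_trans (jt i); right.
  exact: (tree_lt_restriction (t := (d, j i))).
rewrite /settles -map_comp in settled.
case: settled => [/(Ed _ sjd) Ds|noE]; first by left; exists (s \o j).
right=> r tr Dr.
have [r' [r'd sr' Dr']] := D_reflects _ _ sjd (tuple_le_trans sjt tr) Dr.
have [q qj q_cases] := extend_along_injection r' s j_inj.
apply: (noE q) => [n|n|].
- by case: (q_cases n) => [[i <- ->]|->]; [apply: sr'|].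
- by case: (q_cases n) => [[i _ ->]|->]; [apply: r'd|apply: sd].
by rewrite -map_comp (eq_map (g := r') qj); apply/Ed.
Qed.

Lemma tree_free_forest : free_forest (fun t : tree h => t.1).
Proof. by split; [exact: tree_normal_forest|exact: tree_freeness]. Qed.

End GuessedTree.

Lemma free_forest_exists (W : ordset) {oW : omega1 W} :
  diamond W -> exists (S : ordset) (lev : S -> W), free_forest lev.
Proof.
move=> /(diamond_guesses (@node_seq_filtration W _)) [E E_guesses].
have [h good_h] := good_history_exists E.
exists (tree h), (fun t => t.1); exact: tree_free_forest E_guesses good_h.
Qed.

(** * Cones *)

Lemma cone_inj (S : ordset) (p : S) (x y : cone S p) : sval x = sval y -> x = y.
Proof. by case: x y => [x px] [y py]; apply: eq_exist. Qed.

Lemma cone_leP (S : ordset) (p : S) (x y : cone S p) :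
  le x y <-> le (sval x) (sval y).
Proof.
by split=> -[e|xy]; [left; rewrite e|right|left; apply: cone_inj|right].
Qed.

Lemma cone_rooted (S : ordset) (p : S) : rooted (cone S p).
Proof.
have root (s : cone S p) : (forall u, ~ lt u s) -> sval s = p.
  case: s => s [e|ps] // /(_ (exist _ p (le_refl p))) nlt.
  by case: nlt.
by move=> s t /root sp /root tp; apply: cone_inj; rewrite sp tp.
Qed.

Section Cone.
Context {W S : ordset} {oW : omega1 W} {lev : S -> W}.
Variable p : S.
Variables (f : W -> W) (clev : cone S p -> W).
Hypothesis f_incr : forall a b, lt a b -> lt (f a) (f b).
Hypothesis f_ge : forall a, le (lev p) (f a).
Hypothesis f_onto : forall c, le (lev p) c -> exists a, f a = c.
Hypothesis f_clev : forall x, f (clev x) = lev (sval x).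
Implicit Types x y z : cone S p.

Let f_lt := increasing_lt f_incr.
Let f_inj := increasing_inj f_incr.

Section Normal.
Context {nS : normal_forest lev}.

#[local] Instance cone_tree_order : tree_order (cone S p).
Proof.
split; first by split=> [s /= /lt_irr //|t s u /=]; apply: lt_trans.
move=> s t u /= su tu; case: (lt_linear su tu) => st; last by right.
by left; apply/cone_leP.
Qed.

Lemma cone_limit_point x : limit_point (clev x) -> limit_point (lev (sval x)).
Proof.
rewrite -f_clev => -[[b bx] lim]; split; first by exists (f b); apply: f_incr.
move=> c cx; have [|cp] := le_total (lev p) c; last first.
  by exists (f b); [apply: lt_le_trans (f_ge b)|apply: f_incr].
case/f_onto => a fa; move: cx; rewrite -fa -f_lt => /lim [d ad dx].
by exists (f d); apply: f_incr.
Qed.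

Lemma cone_predecessors x y : (forall z, lt z x -> lt z y) ->
  forall u, lt u (sval x) -> lt u (sval y).
Proof.
move=> xy u ux; have [pu|up] := le_linear (proj2_sig x) (or_intror ux).
  exact: (xy (exist _ u pu)).
exact: lt_le_trans up (proj2_sig y).
Qed.

Lemma cone_splits x : exists y z, [/\ y <> z,
  immediate_succ ground (cone S p) x y & immediate_succ ground (cone S p) x z].
Proof.
case: x => x px; have [t [t' [tt' [xt no_t] [xt' no_t']]]] := forest_splits x.
have pt : le p t by right; apply: le_lt_trans xt.
have pt' : le p t' by right; apply: le_lt_trans xt'.
exists (exist _ t pt), (exist _ t' pt'); split; first by case.
  by split=> // -[[u pu] [xu ut]]; apply: no_t; exists u.
by split=> // -[[u pu] [xu ut]]; apply: no_t'; exists u.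
Qed.

Lemma cone_normal_forest : normal_forest clev.
Proof.
split.
- exact: cone_tree_order.
- by move=> s t st; rewrite f_lt !f_clev; apply: lev_lt.
- move=> t b; rewrite f_lt f_clev => /lev_restrict [u ut ub].
  have pu : le p u.
    by apply: le_of_lev (proj2_sig t) (or_intror ut) _; rewrite ub.
  by exists (exist _ u pu) => //; apply: f_inj; rewrite f_clev.
- move=> t b; rewrite f_lt f_clev => /lev_extend [s ts sb].
  have ps : le p s by right; apply: le_lt_trans ts; apply: (proj2_sig t).
  by exists (exist _ s ps) => //; apply: f_inj; rewrite f_clev.
- move=> a.
  apply: (countable_inj (g := sval)) (countable_level (f a)) => [x <-|x y _ _].
    by rewrite /= f_clev.
  exact: cone_inj.
- move=> a; have [s ps sa] := extend_le (f_ge a).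
  by exists (exist _ s ps); apply: f_inj; rewrite f_clev.
- exact: cone_splits.
move=> s t /cone_limit_point lims st same; apply: cone_inj.
apply: limit_unique => //; first by rewrite -!f_clev st.
by move=> u; split; apply: cone_predecessors => z; rewrite same.
Qed.

End Normal.

Lemma cone_freeness {fS : free_forest lev} : free_forest clev.
Proof.
split=> [|I D b]; first exact: cone_normal_forest.
have [a' fba' decD] := freeness
  (fun r => exists2 s : I -> cone S p, forall i, r i = sval (s i) & D s) (f b).
have [a fa] := f_onto (le_trans (f_ge b) fba').
have f_le c d : le (f c) (f d) -> le c d.
  by move=> cd; apply: not_lt => /f_incr /lt_nge.
exists a; first by apply: f_le; rewrite fa.
move=> t ta sep.
have [||[r rt [s rs Ds]]|noD] := decD (sval \o t).
- move=> i; rewrite -fa -f_clev; case: (ta i) => [->|/f_incr]; first by left.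
  by right.
- move=> i j ij u ui uj; have [pu|up] := le_linear (proj2_sig (t i)) ui.
    rewrite -fa -(f_clev (exist _ u pu)); apply/f_incr/(sep i j ij).
      exact/cone_leP.
    exact/cone_leP.
  by apply: lt_le_trans fba'; apply: lt_le_trans (lev_lt up) (f_ge b).
- by left; exists s => // i; apply/cone_leP; rewrite -rs; apply: rt.
right=> s ts Ds; apply: (noD (sval \o s)); last by exists s.
by move=> i; apply/cone_leP.
Qed.

End Cone.

Lemma cone_free_forest (W S : ordset) {oW : omega1 W} (lev : S -> W)
    {fS : free_forest lev} (p : S) :
  exists clev : cone S p -> W, free_forest clev.
Proof.
have [f [f_incr f_ge f_onto]] := omega1_tail_enumeration (lev p).
have /choice [clev f_clev] : forall x : cone S p, exists a, f a = lev (sval x).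
  by move=> x; apply/f_onto/lev_le/(proj2_sig x).
by exists clev; apply: (cone_freeness f_incr f_ge f_onto f_clev).
Qed.

(** * Rooted free forests are Souslin trees *)

Section Ground.
Context {W S : ordset} {oW : omega1 W} {lev : S -> W}.
Implicit Types (a b : W) (s t : S).

Section Normal.
Context {nS : normal_forest lev}.

Lemma lt_iff_lev s t u : lt s u -> lt t u -> lt s t <-> lt (lev s) (lev t).
Proof.
move=> su tu; split; first exact: lev_lt.
exact: lt_of_lev (or_intror su) (or_intror tu).
Qed.

Lemma ground_at_levelP t a : at_level ground W S t a <-> lev t = a.
Proof.
split=> [[f [[dom [tot _]] [_ [onto ord]]]]|<-].
  apply: (back_and_forth_level
    (F := fun s b => s = t /\ b = a \/ f (s, b))); last by left.
  - move=> s b u [[-> ->] ut|fsb us].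
      by have [c fuc] := tot u ut; exists c; [right|case: (dom u c fuc)].
    have [st _] := dom s b fsb; have [c fuc] := tot u (lt_trans us st).
    by exists c; [right|apply/(ord u s c b)].
  move=> s b c [[-> ->] ca|fsb cb].
    by have [u fuc] := onto c ca; exists u; [right|case: (dom u c fuc)].
  have [_ ba] := dom s b fsb; have [u fuc] := onto c (lt_trans cb ba).
  by exists u; [right|apply/(ord u s c b)].
exists (fun x => lt x.1 t /\ lev x.1 = x.2); split; last split; last split.
- split=> [s b /= [st <-]|]; first by split=> //; apply: lev_lt.
  by split=> [s st|s b b' /= [[_ <-] [_ <-]] //]; exists (lev s).
- move=> s s' b /= [[st sb] [s't s'b]].
  by apply: (eq_of_lev (u := t)); rewrite ?sb ?s'b //; right.
- by move=> b /= /lev_restrict [u ut ub]; exists u.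
by move=> s s' b b' /= [[st <-] [s't <-]]; apply: lt_iff_lev st s't.
Qed.

Lemma ground_normal (gW : is_omega1 ground W) (rS : rooted S) :
  is_normal_omega1_tree ground W S.
Proof.
split=> //; split; last split; last split; last split; last split.
- split; first by split=> [s /lt_irr //|s t u [/lt_trans st /st]].
  by move=> t Y [Yt Y0]; have [m] := forest_min_below Yt Y0; exists m.
- split=> [t|a]; first by exists (lev t); apply/ground_at_levelP.
  have [t ta] := level_inhabited (lev := lev) a.
  by exists t; apply/ground_at_levelP.
- move=> a; apply/ground_countableP.
  apply: countable_subset (countable_level a).
  by move=> t /ground_at_levelP.
- by move=> s; have [t [t' []]] := forest_splits s; exists t, t'.
- move=> a s t [lim [/ground_at_levelP sa [/ground_at_levelP ta same]]].
  by apply: rooted_limit_unique => //; rewrite sa.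
move=> t a b [/ground_at_levelP <- /lev_extend [s ts sb]].
by exists s; split=> //; apply/ground_at_levelP.
Qed.

End Normal.

Lemma ground_souslin {fS : free_forest lev} (gW : is_omega1 ground W)
    (rS : rooted S) : is_souslin ground W S.
Proof.
split; first exact: ground_normal.
case=> X [antiX uncX]; apply/uncX/ground_countableP.
have [b _] := @omega1_inhabited W _.
have [a _ decX] := freeness
  (fun z : unit -> S => exists2 x, X x & le x (z tt)) b.
apply: countable_subset (countable_levels_le a) => x Xx; apply: not_lt => ax.
have [u ux ua] := lev_restrict ax.
have [|[] []|[s su [y Xy ys]]|noX] // := decX (fun=> u).
- by move=> _; rewrite ua.
- have yx : lt y x by apply: le_lt_trans ux; apply: le_trans (su tt).
  have [|/(_ yx)] // := antiX y x.
  by split=> //; split=> //; apply: lt_neq.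
by apply: (noX (fun=> x)) => [_|]; [right|exists x].
Qed.

End Ground.

(** * Forcing with distributive posets *)

Class forcing_order (P : poset) : Prop := ForcingOrder {
  stronger_refl : forall p : cond P, stronger p p;
  stronger_trans : forall q p r : cond P,
    stronger p q -> stronger q r -> stronger p r
}.

Definition persistent (P : poset) (phi : cond P -> Prop) : Prop :=
  forall p q, stronger q p -> phi p -> phi q.

Definition dense_closed (P : poset) (phi : cond P -> Prop) : Prop :=
  forall p, dense_below p phi -> phi p.

Definition omega_distributive (P : poset) : Prop :=
  forall (p : cond P) (D : nat -> cond P -> Prop),
    (forall k, persistent (D k)) ->
    exists2 q, stronger q p &
      forall k, D k q \/ forall r, stronger r q -> ~ D k r.

Section Forcing.
Context {P : poset} {fP : forcing_order P}.
Implicit Types p q r : cond P.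

Notation U := (forcing P).
Notation mem := (@tmem U _).

Let reflp p : stronger p p := stronger_refl p.
#[local] Hint Resolve stronger_refl : core.

Lemma mem_persistent (A : Type) (x : A) (X : sub U A) : persistent (mem x X).
Proof. by move=> p q qp Xp r rq; apply: Xp; apply: stronger_trans qp. Qed.

Lemma mem_dense_closed (A : Type) (x : A) (X : sub U A) :
  dense_closed (mem x X).
Proof.
move=> p Xp q /Xp [r [rq Xr]]; have [s [sr Xs]] := Xr r (reflp r).
by exists s; split=> //; apply: stronger_trans rq.
Qed.

Definition check_name (A : Type) (X : set A) : sub U A := fun x _ => X x.

Lemma mem_check_name (A : Type) (X : set A) (x : A) p :
  mem x (check_name X) p <-> X x.
Proof.
split=> [/(_ p (reflp p)) [q [_ [r []]]] //|Xx q qp].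
by exists q; split=> //; exists q.
Qed.

Lemma forces_countable (A : Type) (X : A -> tv U) (Y : set A) p :
  (forall x, persistent (X x)) -> (forall x, dense_closed (X x)) ->
  (forall x q, stronger q p -> X x q -> Y x) -> countable Y ->
  is_countable U X p.
Proof.
move=> X_pers X_dense XY /countable_injectionP [f f_inj] q qp.
exists q; split=> //.
pose F : sub U (A * nat) := fun x r => X x.1 r /\ f x.1 = x.2.
have memF x n r : mem (x, n) F r -> X x r /\ f x = n.
  move=> Fr; split; last by have [_ [_ [s [_ []]]]] := Fr r (reflp r).
  apply: X_dense => s /Fr [t [ts [t' [tt' [Xt' _]]]]]; exists t; split=> //.
  exact: X_pers Xt'.
exists F; split; last first.
  move=> x y n r rq [/memF [Xx fx] /memF [Xy fy]].
  apply: f_inj; last by rewrite fx.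
    by apply: XY Xx; apply: stronger_trans qp.
  by apply: XY Xy; apply: stronger_trans qp.
split; first by move=> x n r rq /memF [].
split=> [x r rq Xx s sr|x m n r rq [/memF [_ <-] /memF [_ <-]] //].
exists s; split=> //; exists (f x) => t ts; exists t; split=> //.
by exists t; split=> //; split=> //; apply: X_pers Xx; apply: stronger_trans sr.
Qed.

Lemma forces_well_ordered (A : ordset) (X : set A) p :
  (forall Y : set A, (forall x, Y x -> X x) -> (exists x, Y x) ->
     exists2 m, Y m & forall x, Y x -> le m x) ->
  is_well_ordered U (fun x => @temb U (X x)) p.
Proof.
move=> woX Y q qp [YX Yex] r rq; have [s [sr [x Yx]]] := Yex r rq.
have [y [t ts Yt]||m [t ts Ym] m_min] :=
  woX (fun x => exists2 t, stronger t s & mem x Y t).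
- by apply: (YX y t) => //; apply: stronger_trans ts (stronger_trans sr rq).
- by exists x, s.
exists t; split; first exact: stronger_trans sr.
exists m; split=> // y t' t't Yy; apply: m_min; exists t' => //.
exact: stronger_trans ts.
Qed.

Lemma forces_immediate_succ (S : ordset) (s t : S) p :
  immediate_succ ground S s t -> immediate_succ U S s t p.
Proof.
case=> st no_u; split=> // q _ /(_ q (reflp q)) [r [_ [u stu]]].
by apply: no_u; exists u.
Qed.

Lemma ground_limit_of_forced (W : ordset) (a : W) p :
  is_limit U W a p -> is_limit ground W a.
Proof.
move=> lim [b [ba b_max]]; apply: (lim p (reflp p)) => q qp.
exists q; split=> //; exists b; split=> // c r _; exact: b_max.
Qed.

Section Absoluteness.
Context {W S : ordset} {oW : omega1 W} {lev : S -> W} {nS : normal_forest lev}.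
Hypothesis distrP : omega_distributive P.

Lemma forces_uncountable (A : Type) p :
  ~ countable [set: A] -> ~ is_countable U (whole U A) p.
Proof.
move=> uncA /(_ p (reflp p)) [q [_ [f [[_ [tot _]] inj]]]].
apply/uncA/countable_injectionP.
have [k p1 q1 qp1 [x fx]|r rq r_dec] :=
  @distrP q (fun k r => exists x, mem (x, k) f r).
  by exists x; apply: mem_persistent fx.
have /choice [g gP] : forall x, exists k,
    exists2 s, stronger s r & mem (x, k) f s.
  move=> x; have [s [sr [k fx]]] := tot x r rq I r (reflp r).
  by exists k, s.
exists g => x y _ _ gxy; have [s sr fx] := gP x; have [t tr fy] := gP y.
rewrite -gxy in fy; case: (r_dec (g x)) => [[z fz]|no_z]; last first.
  by case: (no_z s sr); exists x.
have -> : x = z.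
  apply: (inj x z (g x) s (stronger_trans sr rq)); split=> //.
  exact: mem_persistent fz.
symmetry; apply: (inj y z (g x) t (stronger_trans tr rq)); split=> //.
exact: mem_persistent fz.
Qed.

Lemma forces_omega1 p : is_omega1 U W p.
Proof.
split; last split; last split.
- by split=> [a q _ /lt_irr //|a b c q _ [ab bc]]; apply: lt_trans bc.
- by apply: forces_well_ordered => Y _; apply: has_least.
- move=> a; apply: forces_countable (countable_lt a) => [b q r //|b q|//].
  by move=> /(_ q (reflp q)) [r []].
by move=> q _; apply/forces_uncountable/omega1_uncountable.
Qed.

Lemma lev_of_forced (t : S) (a : W) p : at_level U W S t a p -> lev t = a.
Proof.
move=> /(_ p (reflp p)) [q [_ [f [[dom [tot _]] [_ [onto ord]]]]]].
apply: (back_and_forth_level (F := fun s b => s = t /\ b = a \/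
  exists2 r, stronger r q & mem (s, b) f r)); last by left.
- move=> s b u [[-> ->] ut|[r rq fsb] us].
    have [r [rq [c fuc]]] := tot u q (reflp q) ut q (reflp q).
    by exists c; [right; exists r|case: (dom u c r rq fuc)].
  have [st _] := dom s b r rq fsb.
  have [r' [r'r [c fuc]]] := tot u r rq (lt_trans us st) r (reflp r).
  have r'q : stronger r' q by apply: stronger_trans rq.
  exists c; first by right; exists r'.
  have [] := ord u s c b r' r'q (conj fuc (mem_persistent r'r fsb)).
  by move=> /(_ r' (reflp r') us).
move=> s b c [[-> ->] ca|[r rq fsb] cb].
  have [r [rq [u fuc]]] := onto c q (reflp q) ca q (reflp q).
  by exists u; [right; exists r|case: (dom u c r rq fuc)].
have [_ ba] := dom s b r rq fsb.
have [r' [r'r [u fuc]]] := onto c r rq (lt_trans cb ba) r (reflp r).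
have r'q : stronger r' q by apply: stronger_trans rq.
exists u; first by right; exists r'.
have [_] := ord u s c b r' r'q (conj fuc (mem_persistent r'r fsb)).
by move=> /(_ r' (reflp r') cb).
Qed.

Lemma forces_at_lev (t : S) p : at_level U W S t (lev t) p.
Proof.
move=> q qp; exists q; split=> //.
exists (check_name (fun x : S * W => lt x.1 t /\ lev x.1 = x.2)).
split; last split; last split.
- split=> [s b r _ /mem_check_name /= [st <-]|].
    by split=> //; apply: lev_lt.
  split=> [s r _ st r' _|s b b' r _ [/mem_check_name /= [_ <-]]]; last first.
    by move=> /mem_check_name /= [_ <-].
  by exists r'; split=> //; exists (lev s); apply/mem_check_name.
- move=> s s' b r _ [/mem_check_name /= [st sb] /mem_check_name /= [s't s'b]].
  by apply: (eq_of_lev (u := t)); rewrite ?sb ?s'b //; right.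
- move=> b r _ /lev_restrict [u ut ub] r' _.
  by exists r'; split=> //; exists u; apply/mem_check_name.
move=> s s' b b' r _ [/mem_check_name /= [st <-] /mem_check_name /= [s't <-]].
by split=> r' _; case: (lt_iff_lev st s't).
Qed.

Lemma forces_at_levelP (t : S) (a : W) p : at_level U W S t a p <-> lev t = a.
Proof. by split=> [|<-]; [apply: lev_of_forced|apply: forces_at_lev]. Qed.

Lemma forces_countable_level (a : W) p :
  is_countable U (fun t : S => at_level U W S t a) p.
Proof.
apply: forces_countable (countable_level (lev := lev) a).
- by move=> t q r _ /forces_at_levelP ta; apply/forces_at_levelP.
- move=> t q /(_ q (reflp q)) [r [_ /forces_at_levelP ta]].
  exact/forces_at_levelP.
by move=> t q _ /forces_at_levelP.
Qed.

Lemma forces_normal (rS : rooted S) p : is_normal_omega1_tree U W S p.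
Proof.
split; last split; last split; last split; last split; last split.
- exact: forces_omega1.
- split.
    by split=> [s q _ /lt_irr //|s t u q _ [st tu]]; apply: lt_trans tu.
  by move=> t; apply: forces_well_ordered => Y; apply: forest_min_below.
- split=> [t|a] q qp; exists q; split=> //.
    by exists (lev t); apply/forces_at_levelP.
  have [t ta] := level_inhabited (lev := lev) a.
  by exists t; apply/forces_at_levelP.
- by move=> a; apply: forces_countable_level.
- move=> s q qp; exists q; split=> //.
  have [t [t' [tt' st st']]] := forest_splits s.
  exists t => r rq; exists r; split=> //; exists t'; split=> //.
  by split; apply: forces_immediate_succ.
- move=> a s t q qp [lim [/forces_at_levelP sa [/forces_at_levelP ta same]]].
  apply: rooted_limit_unique => //; rewrite ?sa //.
    exact: ground_limit_of_forced lim.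
  by move=> u; have [su tu] := same u; split=> [/su|/tu]; apply.
move=> t a b q qp [/forces_at_levelP <- /lev_extend [s ts sb]] r rq.
by exists r; split=> //; exists s; split=> //; apply/forces_at_levelP.
Qed.

End Absoluteness.
End Forcing.

(** * Forcing with finite powers of a free forest *)

#[export] Instance tree_power_order (T : ordset) (n : nat)
  {treeT : tree_order T} : forcing_order (tree_power T n).
Proof.
by split=> [p|q p r pq qr]; [apply: tuple_le_refl|apply: tuple_le_trans qr pq].
Qed.

Section TreePower.
Context {W T : ordset} {oW : omega1 W} {lev : T -> W} {fT : free_forest lev}.
Variable n : nat.

Notation P := (tree_power T n).
Notation U := (forcing P).
Notation mem := (@tmem U _).
Notation gen := (generic_branch T n).
Implicit Types (p q r : cond P) (s t u x y z : T) (i : 'I_n) (a : W).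

Let reflp p : stronger p p := stronger_refl p.
#[local] Hint Resolve stronger_refl : core.

Lemma update_stronger q i s : le (q i) s -> stronger (update q i s : cond P) q.
Proof. exact: update_le. Qed.

Lemma stronger_above q a : exists2 r, stronger r q & levels_above lev a r.
Proof.
have /choice [r rP] : forall i, exists s, le (q i) s /\ le a (lev s).
  by move=> i; have [s qs sa] := extend_above (q i) a; exists s.
by exists r => i; case: (rP i).
Qed.

Lemma stronger_pairwise_incomp q : exists2 r, stronger r q & pairwise_incomp r.
Proof. exact: pairwise_incomp_dense. Qed.

Lemma tree_power_distributive : omega_distributive P.
Proof.
move=> p D D_pers; have [q pq inc] := stronger_pairwise_incomp p.
have [a decD] := incomp_decides_seq D inc.
have [r qr ra] := stronger_above q a.
exists r; first exact: stronger_trans qr pq.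
move=> k; case: (decD r qr ra k) => [[s sr Ds]|noD]; last by right.
by left; apply: D_pers Ds.
Qed.

Lemma mem_generic_branch i t q : le t (q i) -> mem t (gen i) q.
Proof.
move=> tq r rq; exists r; split=> //; exists r; split=> //.
exact: le_trans (rq i).
Qed.

Lemma generic_branch_reaches i t q r : mem t (gen i) q -> stronger r q ->
  exists2 p, stronger p r & le t (p i).
Proof.
by move=> Gt /Gt [p [pr [s [ps ts]]]]; exists p => //; apply: le_trans (ps i).
Qed.

Lemma generic_branch_avoids i t q :
  (forall r, stronger r q -> ~ mem t (gen i) r) -> incomp t (q i).
Proof.
move=> nt; split=> [tq|qt]; first exact: nt (reflp q) (mem_generic_branch tq).
apply: (nt _ (update_stronger qt)); apply: mem_generic_branch.
by rewrite update_eq.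
Qed.

Lemma forced_antichain_bounded t q (X : sub U (cone T t)) :
  (forall i, incomp t (q i)) -> is_antichain U (cone T t) X q ->
  exists r a, stronger r q /\
    forall p (x : cone T t), stronger p r -> mem x X p -> le (lev (sval x)) a.
Proof.
move=> t_off antiX; have [r qr inc] := stronger_pairwise_incomp q.
have [i|a ta decX] := incomp_decides_cons (x := t)
  (fun z p => exists2 y : cone T t, mem y X p & le (sval y) z) (lev t) inc.
  exact: incomp_mono (qr i) (t_off i).
exists r, a; split=> // p x pr Xx; apply: not_lt => /lev_restrict [u ux ua].
have tu : le t u.
  by apply: le_of_lev (proj2_sig x) (or_intror ux) _; rewrite ua.
have [p' p'p p'a] := stronger_above p a.
have p'r : stronger p' r by exact: stronger_trans p'p pr.
have p'q : stronger p' q by exact: stronger_trans p'r qr.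
case: (decX u p' tu p'r) => // [||noX]; first by rewrite ua.
  case=> z [s [zu sp' [y Xy yz]]].
  have yx : lt (sval y) (sval x) by apply: le_lt_trans ux; apply: le_trans zu.
  have [|nyx _] := antiX y x p' p'q; last exact: nyx (reflp p') yx.
  split; first exact: mem_persistent Xy.
  split; first exact: mem_persistent Xx.
  by move=> eyx; apply: (lt_neq yx); rewrite eyx.
apply: (noX (sval x) p') => //; first by right.
by exists x => //; apply: mem_persistent Xx.
Qed.

Lemma forces_souslin_cone t q :
  (forall i, incomp t (q i)) -> is_souslin U W (cone T t) q.
Proof.
move=> t_off; have [clev fC] := cone_free_forest t.
split; first exact/forces_normal/cone_rooted/tree_power_distributive.
move=> p pq /(_ p (reflp p)) [r [rp [X [antiX uncX]]]].
have [i|s [a [sr Xa]]] := forced_antichain_bounded _ antiX.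
  by apply: incomp_mono (t_off i) => //; apply: le_trans (pq i) (rp i).
apply: (uncX s sr).
apply: (forces_countable (Y := fun x : cone T t => le (lev (sval x)) a)).
- by move=> x; apply: mem_persistent.
- by move=> x; apply: mem_dense_closed.
- by move=> x p'; apply: Xa.
apply: (countable_inj (g := sval)) (countable_levels_le a) => [//|x y _ _].
exact: cone_inj.
Qed.

Lemma souslin_off_generic_branches : souslin_off_generic_branch W T n.
Proof.
move=> q t r rq off; apply: forces_souslin_cone => i.
by apply: generic_branch_avoids => s sr; apply: off.
Qed.

Section Branch.
Variables (X : sub U T) (q : cond P).
Hypothesis branchX : is_cofinal_branch U W T X q.

Lemma branch_linear s t r :
  stronger r q -> mem s X r -> mem t X r -> ~ incomp s t.
Proof.
case: branchX => [linX _] rq Xs Xt [nst nts].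
have [p [_ [//|ts]]] := linX s t r rq (conj Xs Xt) r (reflp r).
by apply: nts; right.
Qed.

Lemma branch_downward s t r : stronger r q -> le s t -> mem t X r -> mem s X r.
Proof.
case: branchX => [_ [downX _]] rq [->|st] // Xt.
exact: downX s t r rq (conj st Xt).
Qed.

Lemma branch_reaches a r : stronger r q ->
  exists p t, [/\ stronger p r, lev t = a & mem t X p].
Proof.
case: branchX => [_ [_ cofX]] rq.
by have [p [pr [t [/forces_at_levelP ta Xt]]]] := cofX a r rq; exists p, t.
Qed.

Lemma branch_le s t r : stronger r q -> mem s X r -> mem t X r ->
  le (lev s) (lev t) -> le s t.
Proof.
move=> rq Xs Xt st; apply: contrapT => nst.
apply: (branch_linear rq Xs Xt); split=> // ts.
exact/nst/(le_of_lev (le_refl s) ts).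
Qed.

Lemma branch_leaves i r : stronger r q -> ~ same_set U T X (gen i) r ->
  exists p t, [/\ stronger p r, mem t X p & incomp t (p i)].
Proof.
move=> rq differ; apply: contrapT => no_leave; apply: differ.
have along p t : stronger p r -> mem t X p -> le t (p i) \/ le (p i) t.
  move=> pr Xt; apply: contrapT => /not_orP inc; apply: no_leave.
  by exists p, t.
move=> t; split=> p pr.
  move=> Xt p' p'p; have Xt' : mem t X p' by exact: mem_persistent Xt.
  have [tp'|p't] := along p' t (stronger_trans p'p pr) Xt'.
    by exists p'; split=> //; exists p'.
  exists (update p' i t); split; first exact: update_stronger.
  by exists (update p' i t); split=> //; rewrite /generic_branch update_eq.
move=> Gt; apply: mem_dense_closed => p' p'p.
have [s sp' ts] := generic_branch_reaches Gt p'p.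
have sr : stronger s r by exact: stronger_trans sp' (stronger_trans p'p pr).
have [s' [u [s's ut Xu]]] := branch_reaches (lev t) (stronger_trans sr rq).
have ts' : le t (s' i) by exact: le_trans ts (s's i).
exists s'; split; first exact: stronger_trans sp'.
suff -> : t = u by [].
have [us'|s'u] := along s' u (stronger_trans s's sr) Xu.
  exact: eq_of_lev ts' us' _.
by apply: eq_of_lev (le_trans ts' s'u) _ _.
Qed.

Lemma branch_leaves_all r : stronger r q ->
  (forall i p, stronger p r -> ~ same_set U T X (gen i) p) ->
  exists p t, [/\ stronger p r, mem t X p & forall i, incomp t (p i)].
Proof.
move=> rq differ.
suff [p [t [pr Xt inc]]] : exists p t, [/\ stronger p r, mem t X p &
    forall i, i \in enum 'I_n -> incomp t (p i)].
  by exists p, t; split=> // i; apply: inc; rewrite mem_enum.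
elim: (enum _) => [|i l [p [t [pr Xt inc]]]].
  have [a _] := @omega1_inhabited W _.
  have [p [t [pr _ Xt]]] := branch_reaches a rq.
  by exists p, t.
have pq : stronger p q by exact: stronger_trans rq.
have [p' [t' [p'p Xt' inc']]] := branch_leaves pq (differ i p pr).
have p'q : stronger p' q by exact: stronger_trans pq.
have {}Xt : mem t X p' by exact: mem_persistent Xt.
have [m [tm t'm Xm]] : exists m, [/\ le t m, le t' m & mem m X p'].
  have [tt'|t't] := le_total (lev t) (lev t').
    by exists t'; split=> //; apply: branch_le p'q Xt Xt' tt'.
  by exists t; split=> //; apply: branch_le p'q Xt' Xt (lt_le t't).
exists p', m; split=> //; first exact: stronger_trans pr.
move=> j; rewrite in_cons => /orP [/eqP ->|/inc]; first exact: incomp_mono inc'.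
by apply: incomp_mono => //; apply: p'p.
Qed.

(* Decide whether an extension of [t] is forced off [X]: it cannot be, since [X]
   passes above [t], and it can, since [X] contains only one of two incomparable
   nodes. *)
Lemma branch_not_off r t :
  stronger r q -> mem t X r -> (forall i, incomp t (r i)) -> False.
Proof.
move=> rq Xt off; have [r1 r1r inc] := stronger_pairwise_incomp r.
have [i|a ta decX] := incomp_decides_cons
  (fun z p => forall p', stronger p' p -> ~ mem z X p') (lev t) inc (x := t).
  exact: incomp_mono (r1r i) (off i).
have [r2 r21 r2a] := stronger_above r1 a.
have r2r : stronger r2 r by exact: stronger_trans r21 r1r.
have [r3 [x [r32 xa Xx]]] := branch_reaches a (stronger_trans r2r rq).
have r3r : stronger r3 r by exact: stronger_trans r32 r2r.
have r3q : stronger r3 q by exact: stronger_trans r3r rq.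
have tx : le t x.
  by apply: branch_le r3q (mem_persistent r3r Xt) Xx _; rewrite xa.
have [||[z [s [zx r3s noz]]]|noX] // := decX x r3 tx (stronger_trans r32 r21).
- by rewrite xa.
- by move=> i; apply: le_trans (r2a i) _; apply/lev_le/r32.
- exact: noz r3 r3s (branch_downward r3q zx Xx).
have [u [v [xu xv uv]]] := split_incomp x.
have [[s sr3 Xu]|nu] := pselect (exists2 s, stronger s r3 & mem u X s).
  apply: (noX v s); [by right|exact: sr3|move=> s' s's Xv].
  have s'q : stronger s' q.
    exact: stronger_trans s's (stronger_trans sr3 r3q).
  exact: branch_linear s'q (mem_persistent s's Xu) Xv uv.
by apply: (noX u r3) => [||s sr3 Xu]; [right|exact: reflp|apply: nu; exists s].
Qed.

Lemma branch_generic r : stronger r q ->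
  exists p i, stronger p r /\ same_set U T X (gen i) p.
Proof.
move=> rq; apply: contrapT => no.
have [i p pr same|p [t [pr Xt off]]] := branch_leaves_all rq.
  by apply: no; exists p, i.
exact: branch_not_off (stronger_trans pr rq) Xt off.
Qed.

End Branch.

Lemma generic_branch_cofinal i q : is_cofinal_branch U W T (gen i) q.
Proof.
split; last split.
- move=> s t r _ [Gs Gt] r' r'r.
  have [p pr' sp] := generic_branch_reaches Gs r'r.
  have [p' p'p tp'] := generic_branch_reaches Gt (stronger_trans pr' r'r).
  exists p'; split; first exact: stronger_trans pr'.
  exact: le_linear (le_trans sp (p'p i)) tp'.
- move=> s t r _ [st Gt] r' r'r.
  have [p pr' tp] := generic_branch_reaches Gt r'r.
  exists p; split=> //; exists p; split=> //.
  by right; apply: lt_le_trans tp.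
move=> a r _; have [s rs sa] := extend_above (r i) a.
have [t ts ta] := restrict_le sa.
exists (update r i s); split; first exact: update_stronger.
exists t; split; first exact/forces_at_levelP.
by apply: mem_generic_branch; rewrite update_eq.
Qed.

Lemma generic_branch_new i q : is_new U T (gen i) q.
Proof.
move=> q0 _ /(_ q0 (reflp q0)) [r [_ [B B_gen]]].
have [u [v [ru rv uv]]] := split_incomp (r i).
have Bu : B u.
  apply: (B_gen u).1 (update_stronger (lt_le ru)) _.
  by apply: mem_generic_branch; rewrite update_eq.
have Gu : mem u (gen i) r by apply: (B_gen u).2.
have [s sr us] := generic_branch_reaches Gu (update_stronger (lt_le rv)).
by have := sr i; rewrite update_eq; apply: incomp_not_below uv us.
Qed.

Lemma generic_branches_distinct i j q :
  i <> j -> ~ same_set U T (gen i) (gen j) q.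
Proof.
move=> ij same; have [s [t [qs qt st]]] := incomp_dense (q i) (q j).
pose r : cond P := update (update q i s) j t.
have ri : r i = s by rewrite /r update_neq // update_eq.
have rq : stronger r q.
  apply: stronger_trans (update_stronger qs); apply: update_stronger.
  by rewrite update_neq //; apply: nesym.
have Gs : mem s (gen j) r.
  by apply: (same s).1 rq _; apply: mem_generic_branch; rewrite ri.
have [p pr sp] := generic_branch_reaches Gs (reflp r).
by have := pr j; rewrite /r update_eq; apply: incomp_not_below st sp.
Qed.

Lemma exactly_generic_branches :
  forced P (exactly_new_cofinal_branches U W T n).
Proof.
move=> p q qp; exists q; split=> //; exists gen; split; last split.
- by move=> i; split; [apply: generic_branch_cofinal|apply: generic_branch_new].
- by move=> i j r _ ij r' _; apply: generic_branches_distinct.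
move=> X r _ [branchX _] r' r'r.
have [s [i [sr same]]] := branch_generic branchX r'r.
by exists s; split=> //; exists i.
Qed.

Section Automorphism.
Variables (f : sub U (T * T)) (p : cond P).
Hypothesis autf : is_order_iso U (whole U T) (whole U T) f p.

Definition sends q s t : Prop := stronger q p /\ mem (s, t) f q.

Lemma sends_persistent q r s t : stronger r q -> sends q s t -> sends r s t.
Proof.
move=> rq [qp fst]; split; first exact: stronger_trans qp.
exact: mem_persistent fst.
Qed.

Lemma sends_image s q :
  stronger q p -> exists r t, stronger r q /\ sends r s t.
Proof.
case: autf => [[_ [tot _]] _] qp.
have [r [rq [t fst]]] := tot s q qp I q (reflp q).
by exists r, t; split=> //; split=> //; apply: stronger_trans qp.
Qed.

Lemma sends_preimage t q :
  stronger q p -> exists r s, stronger r q /\ sends r s t.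
Proof.
case: autf => [_ [_ [onto _]]] qp.
have [r [rq [s fst]]] := onto t q qp I q (reflp q).
by exists r, s; split=> //; split=> //; apply: stronger_trans qp.
Qed.

Lemma sends_lt q s t s' t' :
  sends q s t -> sends q s' t' -> lt s s' <-> lt t t'.
Proof.
case: autf => [_ [_ [_ ord]]] [qp fst] [_ fst'].
have [st ts] := ord s s' t t' q qp (conj fst fst').
by split=> [/st|/ts]; apply.
Qed.

Lemma sends_le q s t s' t' :
  sends q s t -> sends q s' t' -> le s s' <-> le t t'.
Proof.
move=> f1 f2; have lt12 := sends_lt f1 f2.
case: (f1) (f2) (autf) => qp fst [_ fst'] [[_ [_ funf]] [injf _]].
split=> -[e|/lt12 l]; [left|by right|left|by right].
  by apply: (funf s t t' q qp); split; rewrite // e.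
by apply: (injf s s' t q qp); split; rewrite // e.
Qed.

Lemma sends_incomp q s t : sends q s t -> s <> t -> incomp s t.
Proof.
have not_lt_image s1 : forall t1 r, sends r s1 t1 -> ~ lt s1 t1.
  elim/(well_founded_ind forest_wf): s1 => s1 IH t1 r f1 st.
  have [r' [u [r'r f2]]] := sends_preimage s1 f1.1.
  have us := (sends_lt f2 (sends_persistent r'r f1)).2 st.
  exact: (IH u us s1 r' f2 us).
have not_gt_image s1 : forall t1 r, sends r s1 t1 -> ~ lt t1 s1.
  elim/(well_founded_ind forest_wf): s1 => s1 IH t1 r f1 ts.
  have [r' [u [r'r f2]]] := sends_image t1 f1.1.
  exact: (IH t1 ts u r' f2 ((sends_lt f2 (sends_persistent r'r f1)).1 ts)).
move=> fst ne; split=> -[e|l]; [exact: ne|exact: not_lt_image fst l|exact: ne|].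
exact: not_gt_image fst l.
Qed.

Lemma sends_leaves i q s t : sends q s t -> exists r s' t',
  [/\ stronger r q, le s s', le t t', sends r s' t' &
      incomp s' (r i) /\ incomp t' (r i)].
Proof.
move=> fst; have [x [s1 [qx ss1 xs1]]] := incomp_dense (q i) s.
have r1q := update_stronger qx; set r1 : cond P := update _ _ _ in r1q.
have [r2 [t1 [r21 f1]]] := sends_image s1 (stronger_trans r1q fst.1).
have r2q : stronger r2 q by exact: stronger_trans r21 r1q.
have tt1 := (sends_le (sends_persistent r2q fst) f1).1 ss1.
have [y [t2 [r2y t12 yt2]]] := incomp_dense (r2 i) t1.
have r32 := update_stronger r2y; set r3 : cond P := update _ _ _ in r32.
have [r4 [s2 [r43 f2]]] := sends_preimage t2 (stronger_trans r32 f1.1).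
have r42 : stronger r4 r2 by exact: stronger_trans r43 r32.
have s12 := (sends_le (sends_persistent r42 f1) f2).2 t12.
exists r4, s2, t2; split=> //.
- exact: stronger_trans r2q.
- exact: le_trans s12.
- exact: le_trans t12.
split; apply: incomp_sym.
  apply: incomp_mono s12 xs1; have := r21 i; rewrite /r1 update_eq => xr2.
  exact: le_trans (r42 i).
by apply: incomp_mono yt2 => //; have := r43 i; rewrite /r3 update_eq.
Qed.

Lemma sends_leaves_all q s t : sends q s t -> exists r s' t',
  [/\ stronger r q, le s s', le t t', sends r s' t' &
      forall i, incomp s' (r i) /\ incomp t' (r i)].
Proof.
move=> fst.
suff [r [s' [t' [rq ss' tt' f' off]]]] : exists r s' t',
    [/\ stronger r q, le s s', le t t', sends r s' t' &
        forall i, i \in enum 'I_n -> incomp s' (r i) /\ incomp t' (r i)].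
  by exists r, s', t'; split=> // i; apply: off; rewrite mem_enum.
elim: (enum _) => [|i l [r [s' [t' [rq ss' tt' f' off]]]]].
  by exists q, s, t.
have [r1 [s1 [t1 [r1r s1s t1t f1 off1]]]] := sends_leaves i f'.
exists r1, s1, t1; split=> //.
- exact: stronger_trans rq.
- exact: le_trans s1s.
- exact: le_trans t1t.
move=> j; rewrite in_cons => /orP [/eqP -> //|/off [s'j t'j]].
by split; [apply: incomp_mono s'j|apply: incomp_mono t'j] => //; apply: r1r.
Qed.

Lemma sends_extend_above a q s t : sends q s t -> exists r s' t',
  [/\ stronger r q, le s s', le t t', sends r s' t' &
      [/\ le a (lev s'), le a (lev t') & levels_above lev a r]].
Proof.
move=> fst; have [t1 tt1 t1a] := extend_above t a.
have [r1 [s1 [r1q f1]]] := sends_preimage t1 fst.1.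
have [s2 s12 s2a] := extend_above s1 a.
have [r2 [t2 [r21 f2]]] := sends_image s2 f1.1.
have [r3 r32 r3a] := stronger_above r2 a.
have t12 := (sends_le (sends_persistent r21 f1) f2).1 s12.
have ss1 := (sends_le (sends_persistent r1q fst) f1).2 tt1.
exists r3, s2, t2; split.
- exact: stronger_trans r32 (stronger_trans r21 r1q).
- exact: le_trans s12.
- exact: le_trans t12.
- exact: sends_persistent f2.
by split=> //; apply: le_trans t1a (lev_le t12).
Qed.

(* Decide, for [(y, x)] above [(t, s)], whether the image of [x] is forced to be
   incomparable with [y]: impossible when [y] is that image, yet an extension of [y]
   can avoid the image of a successor of [x]. *)
Lemma sends_not_off q s t : sends q s t -> incomp t s ->
  (forall i, incomp s (q i) /\ incomp t (q i)) -> False.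
Proof.
move=> fst ts off; have [q1 q1q inc] := stronger_pairwise_incomp q.
have [i|i|a _ decf] := incomp_decides_cons2
    (fun y x r => exists2 z, mem (x, z) f r & incomp z y) (lev s) inc ts.
- exact: incomp_mono (q1q i) (off i).2.
- exact: incomp_mono (q1q i) (off i).1.
have [r [x [y [rq1 sx ty fxy [xa ya ra]]]]] :=
  sends_extend_above a (sends_persistent q1q fst).
case: (decf y x r ty sx rq1 ya xa ra) => [[y' [x' [r' [y'y x'x r'r]]]]|nof].
  case=> z fz; have fz_r : sends r x' z.
    by split; [case: fxy|apply: mem_persistent fz].
  have zy := (sends_le fz_r fxy).1 x'x.
  by move=> inc_zy; apply: incomp_not_below inc_zy zy y'y.
have [x1 [_ [xx1 _ _]]] := split_incomp x.
have [r1 [w [r1r fw]]] := sends_image x1 fxy.1.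
have yw := (sends_lt (sends_persistent r1r fxy) fw).1 xx1.
have [y1 yy1 y1w] := incomp_extend yw.
apply: (nof y1 x1 r1 yy1 (lt_le xx1) r1r).
by exists w; [case: fw|apply: incomp_sym].
Qed.

Lemma automorphism_fixes t : mem (t, t) f p.
Proof.
apply: mem_dense_closed => q qp.
have [r [u [rq ftu]]] := sends_image t qp.
have [tu|tu] := pselect (t = u).
  by exists r; split=> //; rewrite {2}tu; case: ftu.
have [r' [t' [u' [_ tt' uu' ft'u' off]]]] := sends_leaves_all ftu.
case: (sends_not_off ft'u' _ off); apply: incomp_sym.
exact: incomp_mono (sends_incomp ftu tu).
Qed.

End Automorphism.

Lemma tree_power_rigid : absolutely_rigid T n.
Proof. by move=> p f q _ autf t; apply: automorphism_fixes. Qed.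

End TreePower.

Theorem theorem2p5 (W : ordset) :
  is_omega1 ground W -> diamond W ->
  exists T : ordset,
    is_souslin ground W T /\
    (forall n : nat, souslin_off_generic_branch W T n) /\
    (forall n : nat, absolutely_UBP W T n /\ absolutely_rigid T n).
Proof.
move=> gW dW; have oW := ground_omega1 gW.
have [S [lev fS]] := free_forest_exists dW.
have [a _] := @omega1_inhabited W _.
have [p _] := level_inhabited (lev := lev) a.
have [clev fT] := cone_free_forest p.
exists (cone S p); split.
  exact: (ground_souslin (lev := clev) gW (@cone_rooted S p)).
split=> n; first exact: (souslin_off_generic_branches (lev := clev)).
split; first exact: (exactly_generic_branches (lev := clev)).
exact: (tree_power_rigid (lev := clev)).
Qed.
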